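(* Let $d\geq 3$ and let $f_0\in\mathbb{C}[x,y]$ be a homogeneous singularity of degree $d$ (a nonzero homogeneous polynomial of degree $d$ without multiple factors). Then $\mathcal{M}(f_0)$ has the form $$\mathcal{M}(f_0)=\big((d-1)^2,\mu_1,\dots,\mu_r,(d-1)(d-2)+1,(d-1)(d-2),\dots,1,0\big),$$ where $\mu_1,\dots,\mu_r$ is some (possibly empty) strictly decreasing sequence of integers; that is, every integer $k$ with $0\le k\le (d-1)(d-2)+1$ is the generic Milnor number of some deformation of $f_0$.
   Context: For a germ $g$ of a holomorphic function at $0\in\mathbb{C}^2$ with an isolated critical point at $0$ and $g(0)=0$, $\mu(g)=\dim_{\mathbb{C}}\mathbb{C}\{x,y\}/(\partial g/\partial x,\partial g/\partial y)$ is its Milnor number. A deformation of an isolated singularity $f_0$ is a germ of a holomorphic function $f(x,y,s):(\mathbb{C}^2\times\mathbb{C},0)\to(\mathbb{C},0)$ with $f(x,y,0)=f_0(x,y)$ and $f(0,0,s)=0$; write $f_s=f(\cdot,\cdot,s)$. $\mu(f_s)$ is constant for sufficiently small $s\neq0$; this constant is the generic Milnor number $\mu^{\mathrm{gen}}(f_s)$, and $\mu^{\mathrm{gen}}(f_s)\le\mu(f_0)$. $\mathcal{M}(f_0)$ denotes the strictly decreasing sequence of all values $\mu^{\mathrm{gen}}(f_s)$ over all deformations $(f_s)$ of $f_0$; its first term is $\mu(f_0)=(d-1)^2$ and its last term is $0$. *)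

(* Defs.v *)
From mathcomp Require Import all_boot all_algebra.
From mathcomp Require Import Rstruct.
From mathcomp.real_closed Require Import complex.
From mathcomp.multinomials Require Import mpoly.
Set Implicit Arguments. Unset Strict Implicit. Unset Printing Implicit Defensive.
Import GRing.Theory Num.Theory.
Local Open Scope ring_scope.

Definition C : numClosedFieldType := (Rdefinitions.R)[i].

(* Power series in two variables x,y: coefficient of x^i y^j. *)
Definition ser2 := nat -> nat -> C.
(* Power series in three variables x,y,s: coefficient of x^i y^j s^k. *)
Definition ser3 := nat -> nat -> nat -> C.

(* Convergent power series (= germs of holomorphic functions at 0):
   positive radius of convergence, i.e. Cauchy-type estimates. *)
Definition convergent2 (a : ser2) : Prop :=
  exists r M : C, 0 < r /\ forall i j, `|a i j| * r ^+ (i + j) <= M.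
Definition convergent3 (a : ser3) : Prop :=
  exists r M : C, 0 < r /\ forall i j k, `|a i j k| * r ^+ (i + j + k) <= M.

Definition mul2 (a b : ser2) : ser2 := fun i j =>
  \sum_(k < i.+1) \sum_(l < j.+1) a k l * b (i - k)%N (j - l)%N.
Definition dx2 (a : ser2) : ser2 := fun i j => a i.+1 j *+ i.+1.
Definition dy2 (a : ser2) : ser2 := fun i j => a i j.+1 *+ j.+1.

(* mu(g) = n : the quotient C{x,y}/(dg/dx, dg/dy) of the ring of convergent
   power series by the Jacobian ideal has C-dimension n: there are n
   convergent series e_0..e_{n-1} whose classes span the quotient and are
   linearly independent in it. *)
Definition milnor (g : ser2) (n : nat) : Prop :=
  exists e : 'I_n -> ser2,
    (forall t, convergent2 (e t)) /\
    (forall h, convergent2 h ->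
       exists (c : 'I_n -> C) (a b : ser2),
         convergent2 a /\ convergent2 b /\
         forall i j, h i j = \sum_(t < n) c t * e t i j
                             + mul2 a (dx2 g) i j + mul2 b (dy2 g) i j) /\
    (forall (c : 'I_n -> C) (a b : ser2),
       convergent2 a -> convergent2 b ->
       (forall i j, \sum_(t < n) c t * e t i j
                    = mul2 a (dx2 g) i j + mul2 b (dy2 g) i j) ->
       forall t, c t = 0).

Definition conv_to (u : nat -> C) (l : C) : Prop :=
  forall eps : C, 0 < eps -> exists N, forall n, (N <= n)%N -> `|u n - l| < eps.

Definition coef2 (f0 : {mpoly C[2]}) : ser2 := fun i j =>
  f0@_[multinom [tuple i; j]].

Definition deformation (f0 : {mpoly C[2]}) (F : ser3) : Prop :=
  [/\ convergent3 F,
      (forall i j, F i j 0%N = coef2 f0 i j) &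
      (forall k, F 0%N 0%N k = 0)].

(* g is the germ f_s = F(.,.,s) (coefficientwise summation in s). *)
Definition fiber (F : ser3) (s : C) (g : ser2) : Prop :=
  forall i j, conv_to (fun n => \sum_(k < n) F i j k * s ^+ k) (g i j).

Definition milnor_fiber (F : ser3) (s : C) (m : nat) : Prop :=
  exists g, fiber F s g /\ milnor g m.

Definition gen_milnor (F : ser3) (m : nat) : Prop :=
  exists r : C, 0 < r /\ forall s : C, 0 < `|s| < r -> milnor_fiber F s m.

Definition homogeneous_singularity (d : nat) (f0 : {mpoly C[2]}) : Prop :=
  [/\ f0 != 0, f0 \is d.-homog &
      forall h q : {mpoly C[2]}, f0 = h * h * q -> (msize h <= 1)%N].

Definition gen_milnor_values (f0 : {mpoly C[2]}) (m : nat) : Prop :=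
  exists F, deformation f0 F /\ gen_milnor F m.

(* Main.v *)
Require Import Defs.
From HB Require Import structures.
From mathcomp Require Import all_boot all_order all_algebra.
From mathcomp Require Import boolp.
From mathcomp Require Import zify ring.
From mathcomp.multinomials Require Import mpoly.
Set Implicit Arguments. Unset Strict Implicit. Unset Printing Implicit Defensive.
Import Order.TTheory GRing.Theory Num.Theory.
Local Open Scope ring_scope.

(** Every value is attained on a linear deformation [f0 + s E].  Write [mu] for the
    colength of [(g_X, g_Y)], where [X = x - rho y], [Y = y], and [i(p, q)] for the
    colength of [(p, q)].  Two facts compute all the colengths: [i(p, q1 q2) =
    i(p, q1) + i(p, q2)], and [i(p, q) = a b] when the initial forms of [p] and [q]
    are coprime of degrees [a] and [b].  For the latter, multiplication by [q] is
    injective from [R/((p) + m^n)] to [R/((p) + m^(n+b))] with cokernel [R/(p, q)] for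
    large [n], so that [i(p, q)] does not depend on [q] and one may take [q = y^b].

    For [m^2 - m - b] with [b < m] the lowest part of [E] is
    [X^(m-b) (Y^b - kappa X^b)]: a combination [A g_Y - B g_X] kills the lowest part, its
    next form is coprime to that of [g_X], and [i(g_X, A)] is subtracted.  For
    [m^2 - m + 1] and for [m^2 - m + a] with [2 <= a < m], [X] is a simple factor of
    [f0] and [E] starts with [X^m], respectively [X^a Y^(m-a) + X^(m+1)]; then [X] divides
    [g_Y] and can be split off.  Since [(m-1)^2 <= k < m^2] for some [m], these three
    families cover all [k]. *)

(** For each [s != 0] the fibre is a finite sum and [s] acts only as a nonzero scalar, so one
    computation serves all small [s]. The difficulty is that the two derivatives of the lowest part
    of [E] usually share a factor, or one of them is zero; the next form then decides the colength
    and has to be controlled. If its degree is [d], it is [f0] itself; if it is smaller, a form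
    imitating [f0] is added to [E], namely [Y^n + X Y^(n-1)] in the first family and [X Y^(n-1)] in
    the other two. Hence the conditionals in the deformations.

    In the first family [X] is chosen not to divide [f0]. In the other two it must divide [f0]
    exactly once, and this is where the absence of multiple factors enters.

    The bound of the theorem comes from degrees: the first two families use forms of degrees [m] and
    [m + 1] and so run up to [m = d - 1], while the third also uses degree [m + 2] and stops at
    [m = d - 2]. For [m = d - 1] only the values up to [(d-1)(d-2) + 1] remain. *)

(** * Power series over a ring; iteration gives two variables *)

Record ps (A : Type) := PS { pscoef :> nat -> A }.

HB.instance Definition _ (A : Type) := gen_eqMixin (ps A).
HB.instance Definition _ (A : Type) := gen_choiceMixin (ps A).

Lemma ps_ext (A : Type) (a b : ps A) : (forall n, a n = b n) -> a = b.
Proof. by case: a b => [f] [g] /= E; congr PS; apply: functional_extensionality_dep. Qed.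

Section PsZmod.
Variable A : zmodType.
Definition ps_zero : ps A := PS (fun=> 0).
Definition ps_opp (a : ps A) : ps A := PS (fun n => - a n).
Definition ps_add (a b : ps A) : ps A := PS (fun n => a n + b n).
Fact ps_addA : associative ps_add.
Proof. by move=> a b c; apply: ps_ext => n; apply: addrA. Qed.
Fact ps_addC : commutative ps_add.
Proof. by move=> a b; apply: ps_ext => n; apply: addrC. Qed.
Fact ps_add0 : left_id ps_zero ps_add.
Proof. by move=> a; apply: ps_ext => n; apply: add0r. Qed.
Fact ps_addN : left_inverse ps_zero ps_opp ps_add.
Proof. by move=> a; apply: ps_ext => n; apply: addNr. Qed.
HB.instance Definition _ := GRing.isZmodule.Build (ps A) ps_addA ps_addC ps_add0 ps_addN.
Lemma psDE (a b : ps A) n : (a + b) n = a n + b n. Proof. by []. Qed.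
Lemma psNE (a : ps A) n : (- a) n = - a n. Proof. by []. Qed.
Lemma ps_sumE (I : Type) (r : seq I) (P : pred I) (F : I -> ps A) n :
  (\sum_(i <- r | P i) F i) n = \sum_(i <- r | P i) F i n.
Proof. by elim/big_rec2: _ => // i x y _ <-. Qed.
End PsZmod.

Section PsRing.
Variable A : comNzRingType.
Definition ps_one : ps A := PS (fun n => (n == 0)%:R).
Definition ps_mul : ps A -> ps A -> ps A := locked (fun a b : ps A =>
  PS (fun n => \sum_(k < n.+1) a k * b (n - k)%N)).
Lemma ps_mulE a b n : ps_mul a b n = \sum_(k < n.+1) a k * b (n - k)%N.
Proof. by rewrite /ps_mul -lock. Qed.
(** A coefficient of a product involves only coefficients of no larger index, so the ring laws are
    inherited from polynomials by truncation. *)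
Definition ps_trunc n (a : ps A) : {poly A} := \poly_(i < n) a i.

Lemma coef_ps_trunc n (a : ps A) i : (i < n)%N -> (ps_trunc n a)`_i = a i.
Proof. by move=> lin; rewrite coef_poly lin. Qed.

Lemma coef_mul_agree m (p q p' q' : {poly A}) :
    (forall i, (i <= m)%N -> p`_i = p'`_i) ->
    (forall i, (i <= m)%N -> q`_i = q'`_i) ->
  forall i, (i <= m)%N -> (p * q)`_i = (p' * q')`_i.
Proof.
move=> Hp Hq i lim; rewrite !coefM; apply: eq_bigr => j _.
by rewrite Hp ?Hq //; have := ltn_ord j; lia.
Qed.

Lemma coef_ps_mul n (a b : ps A) i : (i < n)%N ->
  ps_mul a b i = (ps_trunc n a * ps_trunc n b)`_i.
Proof.
move=> lin; rewrite ps_mulE coefM; apply: eq_bigr => j _.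
by rewrite !coef_ps_trunc //; have := ltn_ord j; lia.
Qed.

Fact ps_mulA : associative ps_mul.
Proof.
move=> a b c; apply: ps_ext => n.
rewrite (@coef_ps_mul n.+1) // (@coef_ps_mul n.+1) //.
rewrite (@coef_mul_agree n _ _ (ps_trunc n.+1 a) (ps_trunc n.+1 b * ps_trunc n.+1 c)) //.
  rewrite mulrA; apply: (@coef_mul_agree n) => // i lin.
  by rewrite coef_ps_trunc // (@coef_ps_mul n.+1).
by move=> i lin; rewrite coef_ps_trunc // (@coef_ps_mul n.+1).
Qed.
Fact ps_mulC : commutative ps_mul.
Proof. by move=> a b; apply: ps_ext => n; rewrite !(@coef_ps_mul n.+1) // mulrC. Qed.
Fact ps_mul1 : left_id ps_one ps_mul.
Proof.
move=> a; apply: ps_ext => n; rewrite ps_mulE big_ord_recl /= mul1r subn0.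
by rewrite big1 ?addr0 // => i _; rewrite /bump /= mul0r.
Qed.
Fact ps_mulD : left_distributive ps_mul +%R.
Proof.
move=> a b c; apply: ps_ext => n; rewrite psDE !ps_mulE -big_split /=.
by apply: eq_bigr => i _; rewrite mulrDl.
Qed.
Fact ps_one_neq0 : ps_one != 0.
Proof. by apply/eqP => /(congr1 (fun a : ps A => a 0%N)) /eqP; rewrite /= oner_eq0. Qed.
HB.instance Definition _ := GRing.Zmodule_isComNzRing.Build (ps A)
  ps_mulA ps_mulC ps_mul1 ps_mulD ps_one_neq0.
Lemma ps1E n : (1 : ps A) n = (n == 0)%:R. Proof. by []. Qed.
Lemma psME (a b : ps A) n : (a * b) n = \sum_(k < n.+1) a k * b (n - k)%N.
Proof. exact: ps_mulE. Qed.
End PsRing.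

(** * The ring of convergent series in two variables *)

Section Germ.
Variable K : numClosedFieldType.
Implicit Types a b c : ps (ps K).

(** The Cauchy estimate with [L] as inverse radius; in this form the bounds of two factors multiply
    directly. *)
Definition geom_bounded a :=
  exists M L : K, [/\ 0 <= M, 0 < L & forall i j, `|a i j| <= M * L ^+ (i + j)].

Lemma ps2ME a b i j :
  (a * b) i j = \sum_(k < i.+1) \sum_(l < j.+1) a k l * b (i - k)%N (j - l)%N.
Proof. by rewrite psME ps_sumE; apply: eq_bigr => k _; rewrite psME. Qed.

(** Each of the [(i+1)(j+1)] terms is at most [M M' (L + L')^(i+j)], and their number is at most
    [2^(i+j)]; hence the factor 2 in the ratio. *)
Lemma geom_boundedM a b : geom_bounded a -> geom_bounded b -> geom_bounded (a * b).
Proof.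
move=> [M [L [M0 L0 Ha]]] [M' [L' [M0' L0' Hb]]].
exists (M * M'), (2 * (L + L')); split; rewrite ?mulr_ge0 //.
  by rewrite mulr_gt0 ?ltr0n ?addr_gt0.
move=> i j; rewrite ps2ME.
have S0 : 0 <= L + L' by rewrite addr_ge0 // ltW.
have B k l : (k <= i)%N -> (l <= j)%N ->
    `|a k l * b (i - k)%N (j - l)%N| <= M * M' * (L + L') ^+ (i + j).
  move=> ki lj; rewrite normrM.
  apply: (le_trans (ler_pM (normr_ge0 _) (normr_ge0 _) (Ha _ _) (Hb _ _))).
  rewrite mulrACA; apply: ler_wpM2l; first by rewrite mulr_ge0.
  have -> : (i + j = (k + l) + (i - k + (j - l)))%N by lia.
  rewrite [X in _ <= X]exprD; apply: ler_pM; rewrite ?exprn_ge0 ?(ltW L0) ?(ltW L0') //.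
    by apply: lerXn2r; rewrite ?nnegrE ?(ltW L0) // lerDl ltW.
  by apply: lerXn2r; rewrite ?nnegrE ?(ltW L0') // lerDr ltW.
apply: (le_trans (ler_norm_sum _ _ _)).
apply: (@le_trans _ _ (\sum_(k < i.+1) \sum_(l < j.+1) M * M' * (L + L') ^+ (i + j))).
  apply: ler_sum => k _; apply: (le_trans (ler_norm_sum _ _ _)).
  by apply: ler_sum => l _; apply: B; rewrite -ltnS.
rewrite !sumr_const !card_ord -mulrnA -[X in X <= _]mulr_natr exprMn [X in _ <= M * M' * X]mulrC [X in _ <= X]mulrA.
apply: ler_wpM2l; first by rewrite ?mulr_ge0 ?exprn_ge0.
rewrite -natrX ler_nat expnD mulnC; apply: leq_mul; exact: ltn_expl.
Qed.

Lemma geom_boundedB a b : geom_bounded a -> geom_bounded b -> geom_bounded (a - b).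
Proof.
move=> [M [L [M0 L0 Ha]]] [M' [L' [M0' L0' Hb]]].
exists (M + M'), (L + L'); split; rewrite ?addr_ge0 ?addr_gt0 //.
move=> i j; rewrite !psDE !psNE mulrDl.
apply: (le_trans (ler_normB _ _)); apply: lerD.
  apply: (le_trans (Ha i j)); apply: ler_wpM2l => //.
  by apply: lerXn2r; rewrite ?nnegrE ?addr_ge0 ?(ltW L0) ?(ltW L0') // lerDl ltW.
apply: (le_trans (Hb i j)); apply: ler_wpM2l => //.
by apply: lerXn2r; rewrite ?nnegrE ?addr_ge0 ?(ltW L0) ?(ltW L0') // lerDr ltW.
Qed.

Lemma geom_bounded_finite a N :
  (forall i j, (N <= i + j)%N -> a i j = 0) -> geom_bounded a.
Proof.
move=> aN.
pose M := \sum_(i < N) \sum_(j < N) `|a i j|.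
have M0 : 0 <= M by apply: sumr_ge0 => i _; apply: sumr_ge0 => j _.
exists M, 1; split => // i j; rewrite expr1n mulr1.
case: (leqP N (i + j)) => [/aN -> | ltN]; first by rewrite normr0.
have iN : (i < N)%N by lia.
have jN : (j < N)%N by lia.
rewrite /M (bigD1 (Ordinal iN)) //= (bigD1 (Ordinal jN)) //= -addrA lerDl.
by rewrite addr_ge0 // sumr_ge0 // => k _; rewrite sumr_ge0.
Qed.

Definition germ_pred : {pred ps (ps K)} := [pred a | `[< geom_bounded a >]].

Lemma germ_subring : subring_closed germ_pred.
Proof.
split=> [|a b|a b]; rewrite ?inE.
- apply/asboolP; apply: (@geom_bounded_finite _ 1) => i j.
  case: i => [|i]; last by rewrite ps1E.
  by case: j => [|j] // _; rewrite ps1E /= ps1E.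
- by move=> /asboolP Ha /asboolP Hb; apply/asboolP; apply: geom_boundedB.
- by move=> /asboolP Ha /asboolP Hb; apply/asboolP; apply: geom_boundedM.
Qed.

HB.instance Definition _ := GRing.isSubringClosed.Build (ps (ps K)) germ_pred germ_subring.

Record germ := Germ { germ_val :> ps (ps K); _ : germ_val \in germ_pred }.
HB.instance Definition _ := [isSub for germ_val].
HB.instance Definition _ := [Choice of germ by <:].
HB.instance Definition _ := [SubChoice_isSubComNzRing of germ by <:].

Lemma germP (p : germ) : geom_bounded p.
Proof. by case: p => a Ha; apply/asboolP. Qed.

Definition mkgerm a (Ha : geom_bounded a) : germ := Germ (introT (asboolP _) Ha).

Lemma germ_ext (p q : germ) : (forall i j, p i j = q i j) -> p = q.
Proof. by move=> E; apply: val_inj; apply: ps_ext => i; apply: ps_ext => j; apply: E. Qed.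

Lemma germ0E i j : (0 : germ) i j = 0. Proof. by []. Qed.
Lemma germ1E i j : (1 : germ) i j = ((i == 0) && (j == 0))%:R.
Proof. by case: i. Qed.
Lemma germDE (p q : germ) i j : (p + q) i j = p i j + q i j. Proof. by []. Qed.
Lemma germNE (p : germ) i j : (- p) i j = - p i j. Proof. by []. Qed.
Lemma germBE (p q : germ) i j : (p - q) i j = p i j - q i j. Proof. by []. Qed.
Lemma germ_sumE (I : Type) (r : seq I) (P : pred I) (F : I -> germ) i j :
  (\sum_(t <- r | P t) F t) i j = \sum_(t <- r | P t) F t i j.
Proof. by elim/big_rec2: _ => // t x y _ <-. Qed.
Lemma germME (p q : germ) i j :
  (p * q) i j = \sum_(k < i.+1) \sum_(l < j.+1) p k l * q (i - k)%N (j - l)%N.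
Proof. exact: ps2ME. Qed.
End Germ.

(** * Order of vanishing, constants and inverses *)

Section Order.
Variable K : numClosedFieldType.
Implicit Types (a b w : ps (ps K)) (p q h : germ K).

Definition ordge n a := forall i j, (i + j < n)%N -> a i j = 0.

Lemma ordge0 n : ordge n 0. Proof. by []. Qed.
Lemma ordge_0 a : ordge 0 a. Proof. by []. Qed.
Lemma ordgeW n m a : (m <= n)%N -> ordge n a -> ordge m a.
Proof. by move=> mn H i j ij; apply: H; lia. Qed.
Lemma ordgeD n a b : ordge n a -> ordge n b -> ordge n (a + b).
Proof. by move=> Ha Hb i j ij; rewrite !psDE Ha ?Hb ?addr0. Qed.
Lemma ordgeN n a : ordge n a -> ordge n (- a).
Proof. by move=> Ha i j ij; rewrite !psNE Ha ?oppr0. Qed.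
Lemma ordgeB n a b : ordge n a -> ordge n b -> ordge n (a - b).
Proof. by move=> Ha Hb; apply: ordgeD => //; apply: ordgeN. Qed.
Lemma ordgeM n m a b : ordge n a -> ordge m b -> ordge (n + m)%N (a * b).
Proof.
move=> Ha Hb i j ij; rewrite ps2ME big1 // => k _; rewrite big1 // => l _.
have [ki lj] := (ltn_ord k, ltn_ord l).
case: (ltnP (k + l) n) => kl; first by rewrite Ha ?mul0r.
by rewrite Hb ?mulr0 //; lia.
Qed.
Lemma ordgeMl n a b : ordge n b -> ordge n (a * b).
Proof. by move=> Hb; rewrite -[n]add0n; apply: ordgeM => //; apply: ordge_0. Qed.
Lemma ordgeX n a : ordge 1%N a -> ordge n (a ^+ n).
Proof.
move=> Ha; elim: n => [|n IHn]; first exact: ordge_0.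
by rewrite exprS -add1n; apply: ordgeM.
Qed.

Lemma mul_agree n a b b' :
    (forall i j, (i + j <= n)%N -> b i j = b' i j) ->
  forall i j, (i + j <= n)%N -> (a * b) i j = (a * b') i j.
Proof.
move=> E i j ij; rewrite !ps2ME; apply: eq_bigr => k _; apply: eq_bigr => l _.
by rewrite E //; have [ki lj] := (ltn_ord k, ltn_ord l); lia.
Qed.

(** For [w] of order at least 1, [w^n] reaches the coefficient of [x^i y^j] only when [n <= i + j],
    so this finite sum is the whole geometric series. *)
Definition geom_series w : ps (ps K) :=
  PS (fun i => PS (fun j => \sum_(n < (i + j).+1) (w ^+ n) i j)).

Lemma geom_seriesE w : ordge 1%N w -> (1 - w) * geom_series w = 1.
Proof.
move=> w0; apply: ps_ext => i; apply: ps_ext => j.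
rewrite (@mul_agree (i + j) _ _ (\sum_(n < (i + j).+1) w ^+ n)) //; last first.
  move=> k l kl; rewrite !ps_sumE /=.
  rewrite -!(big_mkord predT (fun n => (w ^+ n) k l)).
  rewrite [RHS](big_cat_nat _ (n := (k + l).+1)) //=.
  rewrite [X in _ = _ + X]big_nat_cond [X in _ = _ + X]big1 ?addr0 // => n /andP[/andP[kln _] _].
  by apply: (ordgeX w0).
have -> : (1 - w) * (\sum_(n < (i + j).+1) w ^+ n) = 1 - w ^+ (i + j).+1.
  by rewrite -opprB mulNr -subrX1 opprB.
by rewrite !psDE !psNE (ordgeX w0) ?subr0.
Qed.

Lemma sum_halves_le1 n : \sum_(k < n) (2%:R^-1 : K) ^+ k.+1 <= 1.
Proof.
have E : \sum_(k < n) (2%:R^-1 : K) ^+ k.+1 = 1 - 2%:R^-1 ^+ n.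
  elim: n => [|n IH]; first by rewrite big_ord0 subrr.
  rewrite big_ord_recr /= IH exprS.
  by field.
by rewrite E gerBl exprn_ge0 // invr_ge0 ler0n.
Qed.

(** The identity [y = 1 + w y], with [w] free of constant term, is a recursion for the coefficients
    of [y]. The weights [2^-(k+1) 2^-(l+1)] sum to at most 1, so once [w] is bounded by them times
    [B^(k+l)], the bound [B^(i+j)] for [y] reproduces itself. *)
Lemma geom_series_bounded w :
  ordge 1%N w -> geom_bounded w -> geom_bounded (geom_series w).
Proof.
move=> w0 [M [L [M0 L0 Hw]]].
(* The factor 2 pays for [2^-(k+l)]; for [n >= 1], [(1 + 4M)^n >= 4M] pays for [M] and the remaining
   [1/4]. *)
pose y := geom_series w; pose B := 2%:R * (L * (1 + 4%:R * M)).
have c0 : 0 < 1 + 4%:R * M by rewrite ltr_pwDl // mulr_ge0.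
have B0 : 0 < B by rewrite /B !mulr_gt0.
have wB k l : `|w k l| <= B ^+ (k + l) * (2%:R^-1 ^+ k.+1 * 2%:R^-1 ^+ l.+1).
  have [kl|kl] := ltnP (k + l) 1.
    by rewrite w0 // normr0 !mulr_ge0 ?exprn_ge0 ?invr_ge0 // ltW.
  apply: (le_trans (Hw k l)); rewrite -exprD addSn addnS.
  set n := (k + l)%N in kl *.
  rewrite !exprS /B exprMn.
  have -> : 2%:R ^+ n * (L * (1 + 4%:R * M)) ^+ n * (2%:R^-1 * (2%:R^-1 * 2%:R^-1 ^+ n))
          = (2%:R * 2%:R^-1) ^+ n * (L ^+ n * (4%:R^-1 * (1 + 4%:R * M) ^+ n)) :> K.
    by rewrite [in RHS]exprMn [in LHS]exprMn; field.
  rewrite mulfV ?pnatr_eq0 // expr1n mul1r mulrC ler_pM2l ?exprn_gt0 //.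
  rewrite -(prednK kl) exprS mulrA.
  apply: (@le_trans _ _ (4%:R^-1 * (1 + 4%:R * M))).
    by rewrite mulrDr mulrA mulVf ?pnatr_eq0 // mul1r mulr1 lerDr invr_ge0.
  rewrite -[X in X <= _]mulr1; apply: ler_wpM2l.
    by rewrite mulr_ge0 ?invr_ge0 // ltW.
  by apply: exprn_ege1; rewrite lerDl mulr_ge0.
have yE i j : y i j = ((i == 0%N) && (j == 0%N))%:R
      + \sum_(k < i.+1) \sum_(l < j.+1) w k l * y (i - k)%N (j - l)%N.
  rewrite -ps2ME; have := geom_seriesE w0; rewrite -/y mulrBl mul1r => /eqP.
  by rewrite subr_eq => /eqP {1}->; rewrite !psDE ps1E; case: i => //= i.
exists 1, B; split => // i j; rewrite mul1r -/y.
have [n] := ubnP (i + j); elim: n i j => // n IH i j ijn.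
rewrite yE; case: (posnP (i + j)) => [ij0|ij0].
  have [-> ->] : i = 0%N /\ j = 0%N by lia.
  by rewrite !big_ord1 w0 // mul0r addr0 normr1 expr0.
have -> : ((i == 0%N) && (j == 0%N)) = false by apply/negP => /andP[/eqP ? /eqP ?]; lia.
rewrite add0r; apply: (le_trans (ler_norm_sum _ _ _)).
apply: (@le_trans _ _ (\sum_(k < i.+1) \sum_(l < j.+1)
    B ^+ (i + j) * (2%:R^-1 ^+ k.+1 * 2%:R^-1 ^+ l.+1))).
  apply: ler_sum => k _; apply: (le_trans (ler_norm_sum _ _ _)).
  apply: ler_sum => l _; have [ki lj] := (ltn_ord k, ltn_ord l).
  have [kl|kl] := ltnP (k + l) 1.
    by rewrite w0 // mul0r normr0 !mulr_ge0 ?exprn_ge0 ?invr_ge0 // ltW.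
  rewrite normrM; apply: (le_trans (ler_pM (normr_ge0 _) (normr_ge0 _) (wB _ _) (IH _ _ _))).
    by lia.
  have -> : (i + j = (k + l) + (i - k + (j - l)))%N by lia.
  by rewrite [X in _ <= X * _]exprD mulrAC.
under eq_bigr do rewrite -big_distrr /= -big_distrr /=.
rewrite -big_distrr -[X in _ <= X]mulr1 /=; apply: ler_wpM2l.
  by rewrite exprn_ge0 // ltW.
rewrite -big_distrl /= -[X in _ <= X]mulr1; apply: ler_pM; rewrite ?sum_halves_le1 //.
  by apply: sumr_ge0 => k _; rewrite exprn_ge0 ?invr_ge0.
by apply: sumr_ge0 => k _; rewrite exprn_ge0 ?invr_ge0.
Qed.

Definition kcs (c : K) : ps (ps K) :=
  PS (fun i => PS (fun j => c *+ ((i == 0%N) && (j == 0%N)))).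
Lemma kcs_bounded c : geom_bounded (kcs c).
Proof. by apply: (@geom_bounded_finite _ _ 1) => -[|i] [|j]. Qed.
Definition kc c : germ K := mkgerm (kcs_bounded c).

Lemma kcE c i j : kc c i j = c *+ ((i == 0%N) && (j == 0%N)). Proof. by []. Qed.
Lemma kcME c p i j : (kc c * p) i j = c * p i j.
Proof.
rewrite germME big_ord_recl big_ord_recl kcE /= !subn0 big1 ?addr0 => [|l _]; last first.
  by rewrite mul0r.
by rewrite big1 ?addr0 // => k _; rewrite big1 // => l _; rewrite mul0r.
Qed.

Fact kc_additive : zmod_morphism kc.
Proof.
by move=> c d; apply: germ_ext => i j; rewrite germBE !kcE; case: (_ && _); rewrite ?subr0.
Qed.
Fact kc_multiplicative : monoid_morphism kc.
Proof.
split=> [|c d]; apply: germ_ext => i j; first by rewrite germ1E kcE; case: (_ && _).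
by rewrite kcME !kcE; case: (_ && _); rewrite ?mulr1n ?mulr0n ?mulr0.
Qed.
HB.instance Definition _ := GRing.isZmodMorphism.Build K (germ K) kc kc_additive.
HB.instance Definition _ := GRing.isMonoidMorphism.Build K (germ K) kc kc_multiplicative.

Definition ev0 p : K := p 0%N 0%N.
Fact ev0_additive : zmod_morphism ev0. Proof. by []. Qed.
Fact ev0_multiplicative : monoid_morphism ev0.
Proof. by split=> [|p q]; rewrite /ev0 ?germ1E // germME !big_ord1. Qed.
HB.instance Definition _ := GRing.isZmodMorphism.Build (germ K) K ev0 ev0_additive.
HB.instance Definition _ := GRing.isMonoidMorphism.Build (germ K) K ev0 ev0_multiplicative.

Lemma germ_unit p : ev0 p != 0 -> exists q, p * q = 1.
Proof.
move=> p0; pose w := 1 - kc (ev0 p)^-1 * p.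
have w0 : ordge 1%N (germ_val w).
  move=> [|i] [|j] // _; rewrite germBE germ1E kcME /= -/(ev0 p) mulVf // subrr.
  by [].
exists (kc (ev0 p)^-1 * mkgerm (geom_series_bounded w0 (germP w))).
rewrite mulrCA mulrA (_ : kc _ * p = 1 - w); last by rewrite /w opprB addrC subrK.
by apply: val_inj; rewrite /= geom_seriesE.
Qed.
End Order.

(** * Dimension of quotients *)

Section QuotientDimension.
Variables (K : fieldType) (R : comNzRingType) (kc : {rmorphism K -> R}).
Implicit Types I J : R -> Prop.

Definition subspace I :=
  [/\ I 0, forall p q, I p -> I q -> I (p + q) & forall c p, I p -> I (kc c * p)].

Definition lincomb n (c : 'I_n -> K) (e : 'I_n -> R) := \sum_(t < n) kc (c t) * e t.

Lemma lincomb_sub I n c (e : 'I_n -> R) :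
  subspace I -> (forall t, I (e t)) -> I (lincomb c e).
Proof.
by move=> [I0 ID IZ] Ie; rewrite /lincomb; elim/big_ind: _ => // t _; apply: IZ.
Qed.

Definition spans I n (e : 'I_n -> R) := forall h, exists c, I (h - lincomb c e).
Definition indep I n (e : 'I_n -> R) :=
  forall c, I (lincomb c e) -> forall t, c t = 0.
(** The dimension of [R/I], stated through representatives in [R] in the same way as [milnor]. *)
Definition qdim I n := exists e : 'I_n -> R, spans I e /\ indep I e.

Lemma qdim_ext I J n : (forall h, I h <-> J h) -> qdim I n -> qdim J n.
Proof.
move=> E [e [S D]]; exists e; split=> [h|c /E]; last exact: D.
by have [c /E Jc] := S h; exists c.
Qed.

(** Additivity along [0 -> R/I -> R/J -> R/J' -> 0], the first map being multiplication by [q]: the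
    hypotheses say [I = (J : q)] and [J' = J + qR]. *)
Lemma qdim_exact I J J' q n1 n2 : subspace J ->
    (forall h, I h <-> J (q * h)) -> (forall h, J' h <-> exists k, J (h - q * k)) ->
  qdim I n1 -> qdim J' n2 -> qdim J (n1 + n2).
Proof.
move=> sJ EI EJ' [e1 [S1 D1]] [e2 [S2 D2]].
pose e t := match split t with inl i => q * e1 i | inr j => e2 j end.
have eE (c : 'I_(n1 + n2) -> K) : lincomb c e =
    q * lincomb (fun i => c (lshift n2 i)) e1 + lincomb (fun j => c (rshift n1 j)) e2.
  rewrite /lincomb big_split_ord /= big_distrr /=; congr (_ + _); apply: eq_bigr => i _.
    by rewrite /e (unsplitK (inl i)) mulrCA.
  by rewrite /e (unsplitK (inr i)).
exists e; split=> [h|c].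
  have [c2 /EJ'[k Jk]] := S2 h.
  have [c1 /EI Jc1] := S1 k.
  pose c t := match split t with inl i => c1 i | inr j => c2 j end.
  exists c; rewrite eE.
  have -> : lincomb (fun i => c (lshift n2 i)) e1 = lincomb c1 e1.
    by apply: eq_bigr => i _; rewrite /c (unsplitK (inl i)).
  have -> : lincomb (fun i => c (rshift n1 i)) e2 = lincomb c2 e2.
    by apply: eq_bigr => i _; rewrite /c (unsplitK (inr i)).
  rewrite (_ : h - _ = (h - lincomb c2 e2 - q * k) + q * (k - lincomb c1 e1)).
    by case: sJ => _ H _; apply: H.
  by ring.
rewrite eE => Jc.
have c2 : forall t, c (rshift n1 t) = 0.
  apply: D2; apply/EJ'; exists (- lincomb (fun i => c (lshift n2 i)) e1).
  by rewrite mulrN opprK addrC.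
have c1 : forall t, c (lshift n2 t) = 0.
  apply: D1; apply/EI; move: Jc; rewrite [X in _ + X]big1 ?addr0 // => t _.
  by rewrite c2 rmorph0 mul0r.
by move=> t; rewrite -(splitK t); case: (split t) => i /=.
Qed.

(** Expressing [f] through [e] modulo [I] gives an [m x n] matrix; for [m > n] a nonzero vector in
    its left kernel is a relation among the [f]. *)
Lemma spans_le I n m (e : 'I_n -> R) (f : 'I_m -> R) : subspace I ->
  spans I e -> indep I f -> (m <= n)%N.
Proof.
move=> sI Se Df; rewrite leqNgt; apply/negP => ltnm.
have [A HA] := choice (fun t => Se (f t)).
pose M : 'M[K]_(m, n) := \matrix_(i, j) A i j.
have : kermx M != 0.
  by rewrite kermx_eq0 /row_free; apply/eqP => rM; have := rank_leq_col M; lia.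
case/rowV0Pn => v /sub_kermxP vM; apply/negP; rewrite negbK; apply/eqP.
apply/rowP => t; rewrite mxE; move: t; apply: Df.
have -> : lincomb (v 0) f = lincomb (v 0) (fun t => f t - lincomb (A t) e).
  apply/eqP; rewrite -subr_eq0; apply/eqP; rewrite /lincomb -sumrB.
  under eq_bigr do rewrite -mulrBr opprB addrC subrK big_distrr /=.
  rewrite exchange_big big1 //= => j _.
  transitivity (kc ((v *m M) 0 j) * e j); last by rewrite vM mxE rmorph0 mul0r.
  rewrite mxE rmorph_sum big_distrl; apply: eq_bigr => t _.
  by rewrite mxE rmorphM mulrA.
exact: lincomb_sub.
Qed.

Lemma qdim_uniq I n m : subspace I -> qdim I n -> qdim I m -> n = m.
Proof.
move=> sI [e [Se De]] [f [Sf Df]].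
by have := spans_le sI Se Df; have := spans_le sI Sf De; lia.
Qed.

(** As long as there is a nontrivial relation modulo [I], a generator with nonzero coefficient can
    be eliminated. *)
Lemma spans_qdim I n (e : 'I_n -> R) : subspace I -> spans I e -> exists m, qdim I m.
Proof.
move=> sI; elim: n e => [|n IH] e Se.
  by exists 0%N, e; split=> // c _ [].
have [De|nD] := pselect (indep I e); first by exists n.+1, e.
have [c nc] : exists c, ~ (I (lincomb c e) -> forall t, c t = 0).
  by apply: contrapT => H; apply: nD => c; apply: contrapT => Hc; apply: H; exists c.
have Ic : I (lincomb c e) by apply: contrapT => H; apply: nc.
have [t /eqP ct] : exists t, c t <> 0.
  by apply: contrapT => H; apply: nc => _ t; apply: contrapT => Hc; apply: H; exists t.
have lift_sum (c' : 'I_n.+1 -> K) : lincomb c' e =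
    kc (c' t) * e t + lincomb (fun i => c' (lift t i)) (fun i => e (lift t i)).
  rewrite /lincomb (bigD1 t) //=; congr (_ + _).
  rewrite (reindex_omap (lift t) (unlift t)) /=; last first.
    by move=> i; rewrite eq_sym => /unlift_some[j -> ->].
  apply: eq_bigl => i; by rewrite liftK eqxx andbT eq_sym neq_lift.
apply: (IH (fun i => e (lift t i))) => h.
have [c' Ic'] := Se h.
exists (fun i => c' (lift t i) - c' t / c t * c (lift t i)).
have -> : h - lincomb (fun i => c' (lift t i) - c' t / c t * c (lift t i))
      (fun i => e (lift t i)) = (h - lincomb c' e) + kc (c' t / c t) * lincomb c e.
  rewrite !lift_sum.
  have -> : lincomb (fun i => c' (lift t i) - c' t / c t * c (lift t i))
      (fun i => e (lift t i)) =
      lincomb (fun i => c' (lift t i)) (fun i => e (lift t i))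
      - kc (c' t / c t) * lincomb (fun i => c (lift t i)) (fun i => e (lift t i)).
    rewrite /lincomb big_distrr -sumrB; apply: eq_bigr => i _ /=.
    by rewrite rmorphB [in LHS]rmorphM mulrBl mulrA.
  rewrite mulrDr mulrA -rmorphM divfK //.
  by ring.
by case: sI => _ D Z; apply: D => //; apply: Z.
Qed.

Lemma qdim_quot I J n : subspace J -> (forall h, I h -> J h) ->
  qdim I n -> exists m, qdim J m.
Proof.
move=> sJ IJ [e [Se _]]; apply: (@spans_qdim _ n e) => // h.
by have [c Ic] := Se h; exists c; apply: IJ.
Qed.
End QuotientDimension.

(** * Forms, monomials and ideals with two generators *)

Section Forms.
Variable K : numClosedFieldType.
Implicit Types (p q h z : germ K) (P Q : {poly K}).

Definition homs n P : ps (ps K) := PS (fun i => PS (fun j => P`_i *+ (i + j == n)%N)).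
Lemma homs_bounded n P : geom_bounded (homs n P).
Proof. by apply: (@geom_bounded_finite _ _ n.+1) => i j ij /=; rewrite gtn_eqF. Qed.
(* [hom n P] is the form [sum_(i <= n) P_i x^i y^(n-i)], the homogenization of [P]. *)
Definition hom n P : germ K := mkgerm (homs_bounded n P).

Lemma homE n P i j : hom n P i j = P`_i *+ (i + j == n)%N. Proof. by []. Qed.

Lemma hom_ordge n P : ordge n (hom n P).
Proof. by move=> i j ij; rewrite homE ltn_eqF. Qed.

Lemma homD n P Q : hom n (P + Q) = hom n P + hom n Q.
Proof. by apply: germ_ext => i j; rewrite germDE !homE coefD mulrnDl. Qed.
Lemma homN n P : hom n (- P) = - hom n P.
Proof. by apply: germ_ext => i j; rewrite germNE !homE coefN mulNrn. Qed.
Lemma homB n P Q : hom n (P - Q) = hom n P - hom n Q.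
Proof. by rewrite homD homN. Qed.
Lemma hom0 n : hom n 0 = 0.
Proof. by apply: germ_ext => i j; rewrite homE coef0 mul0rn. Qed.
Lemma homZ n c P : hom n (c *: P) = kc c * hom n P.
Proof. by apply: germ_ext => i j; rewrite kcME !homE coefZ mulrnAr. Qed.
Lemma hom_kc c : hom 0 c%:P = kc c.
Proof. by apply: germ_ext => -[|i] [|j]; rewrite [LHS]homE [RHS]kcE coefC. Qed.

(** [hom n P] discards the coefficients of [P] beyond index [n]; the size bounds ensure that nothing
    is lost before multiplying. *)
Lemma homM n m P Q : (size P <= n.+1)%N -> (size Q <= m.+1)%N ->
  hom n P * hom m Q = hom (n + m)%N (P * Q).
Proof.
move=> sP sQ; apply: germ_ext => i j; rewrite germME homE coefM.
have [ij|ij] := eqVneq (i + j)%N (n + m)%N; last first.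
  rewrite mulr0n big1 // => k _; rewrite big1 // => l _; rewrite !homE.
  have [kl|kl] := eqVneq (k + l)%N n; last by rewrite mulr0n mul0r.
  have [ki lj] := (ltn_ord k, ltn_ord l).
  have [kl'|kl'] := eqVneq (i - k + (j - l))%N m; last by rewrite mulr0n mulr0.
  by lia.
rewrite mulr1n; apply: eq_bigr => k _; have ki := ltn_ord k.
have [/andP[kn nkj]|H] := boolP ((k <= n)%N && (n - k <= j)%N).
  have lt : (n - k < j.+1)%N by lia.
  rewrite (bigD1 (Ordinal lt)) //= big1 ?addr0 => [|l nl]; last first.
    have /eqP nl' : (l : nat) != (n - k)%N by rewrite -val_eqE in nl.
    have -> : (k + l == n)%N = false by apply/eqP; lia.
    by rewrite mulr0n mul0r.
  have -> : (k + (n - k) == n)%N by apply/eqP; lia.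
  by have -> : (i - k + (j - (n - k)) == m)%N by apply/eqP; lia.
rewrite big1 => [|l _]; last first.
  have lj := ltn_ord l; rewrite homE.
  have -> : (k + l == n)%N = false by apply/eqP; lia.
  by rewrite mulr0n mul0r.
have [kn|kn] := ltnP n k; first by rewrite [P`_k]nth_default ?mul0r //; apply: leq_trans kn.
by rewrite [Q`__]nth_default ?mulr0 //; apply: leq_trans sQ _; lia.
Qed.

Lemma hom_lead n h : ordge n h ->
  ordge n.+1 (h - hom n (\poly_(i < n.+1) h i (n - i)%N)).
Proof.
move=> oh i j ij; rewrite germBE homE coef_poly.
case: eqP => [E|E]; last by rewrite mulr0n subr0 oh //; lia.
have -> : (i < n.+1)%N by lia.
have -> : (n - i = j)%N by lia.
by rewrite mulr1n subrr.
Qed.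

Lemma hom_ordgeS_eq0 n P : (size P <= n.+1)%N -> ordge n.+1 (hom n P) -> P = 0.
Proof.
move=> sP oP; apply/polyP => i; rewrite coef0.
have [ni|ni] := ltnP n i; first by rewrite nth_default //; apply: leq_trans ni.
have := oP i (n - i)%N; rewrite homE (_ : i + (n - i) = n)%N; last by lia.
by rewrite eqxx; apply.
Qed.

Lemma homXE N i z k l : (i <= N)%N -> (hom N 'X^i * z) k l =
  z (k - i)%N (l - (N - i))%N *+ ((i <= k) && (N - i <= l))%N.
Proof.
move=> iN; rewrite germME.
have Z (k' : 'I_k.+1) (l' : 'I_l.+1) : (k' != i :> nat) || (l' != (N - i)%N :> nat) ->
    hom N 'X^i k' l' * z (k - k')%N (l - l')%N = 0.
  rewrite homE coefXn => H.
  have [E|_] := eqVneq (k' + l')%N N; last by rewrite mulr0n mul0r.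
  have [Ek|_] := eqVneq (k' : nat) i; last by rewrite mul0rn mul0r.
  by move: H; rewrite Ek eqxx /=; case: eqP => //; lia.
case: (boolP (_ && _)) => [/andP[ik Nl]|H].
  rewrite -[(i <= k)%N]ltnS in ik; rewrite -[(N - i <= l)%N]ltnS in Nl.
  rewrite (bigD1 (Ordinal ik)) //= (bigD1 (Ordinal Nl)) //=.
  rewrite [X in _ + X + _]big1 => [|l' nl]; last first.
    by apply: (Z (Ordinal ik) l'); rewrite -val_eqE in nl; rewrite nl orbT.
  rewrite [X in _ + X]big1 ?addr0 => [|k' nk]; last first.
    by rewrite big1 // => l' _; apply: (Z k' l'); rewrite -val_eqE in nk; rewrite nk.
  rewrite coefXn eqxx.
  have -> : (i + (N - i) == N)%N by apply/eqP; lia.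
  by rewrite !mulr1n mul1r.
rewrite big1 // => k' _; rewrite big1 // => l' _; apply: Z.
by have [A B] := (ltn_ord k', ltn_ord l'); case: eqP => //=; lia.
Qed.

Definition xpow N : germ K := hom N 'X^N.
Definition ypow N : germ K := hom N 1.

Lemma xpowE N z k l : (xpow N * z) k l = z (k - N)%N l *+ (N <= k)%N.
Proof. by rewrite homXE // subnn subn0 leq0n andbT. Qed.
Lemma ypowE N z k l : (ypow N * z) k l = z k (l - N)%N *+ (N <= l)%N.
Proof. by rewrite /ypow -(expr0 'X) homXE // !subn0. Qed.
Lemma xpowM N M : xpow N * xpow M = xpow (N + M).
Proof. by rewrite homM ?size_polyXn // -exprD. Qed.
Lemma ypowM N M : ypow N * ypow M = ypow (N + M).
Proof. by rewrite homM ?size_poly1 // mulr1. Qed.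

(** The product of the lexicographically lowest terms of two nonzero germs cannot cancel. *)
Lemma germ_neq0_mulI p u : p != 0 -> p * u = 0 -> u = 0.
Proof.
have low a : a != 0 :> germ K -> exists i j, [/\ a i j != 0,
    forall k l, (k < i)%N -> a k l = 0 & forall l, (l < j)%N -> a i l = 0].
  move=> a0.
  have [i [j' Hij]] : exists i j, a i j != 0.
    apply: contrapT => H; move/eqP: a0; apply; apply: germ_ext => i j; apply/eqP.
    by apply: contrapT => /negP Hij; apply: H; exists i, j.
  have [i0 /asboolP[j1 Hj1] Hi0] : exists2 i0, `[< exists j, a i0 j != 0 >] &
      forall k, `[< exists j, a k j != 0 >] -> (i0 <= k)%N.
    have EX : exists i, `[< exists j, a i j != 0 >] by exists i; apply/asboolP; exists j'.
    by exists (ex_minn EX); case: ex_minnP.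
  have EX : exists j, a i0 j != 0 by exists j1.
  case: (ex_minnP EX) => j0 Hj0 Mj0; exists i0, j0; split=> // [k l ki|l lj].
    apply/eqP; apply: contraLR ki => akl; rewrite -leqNgt; apply: Hi0.
    by apply/asboolP; exists l.
  by apply/eqP; apply: contraLR lj => /Mj0; rewrite -leqNgt.
move=> p0 pu; apply/eqP; apply: contrapT => /negP u0.
have [i [j [pij p1 p2]]] := low p p0; have [k [l [ukl u1 u2]]] := low u u0.
have := congr1 (fun a : germ K => a (i + k)%N (j + l)%N) pu; rewrite germME germ0E.
have Z (s : 'I_(i + k).+1) (t : 'I_(j + l).+1) : (s != i :> nat) || (t != j :> nat) ->
    p s t * u (i + k - s)%N (j + l - t)%N = 0.
  move=> H; have [A B] := (ltn_ord s, ltn_ord t).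
  case: (ltngtP s i) H => [si|si|si] /= H.
  - by rewrite p1 ?mul0r.
  - by rewrite (u1 (i + k - s)%N) ?mulr0 //; lia.
  case: (ltngtP t j) H => [tj|tj|//] _; first by rewrite si p2 ?mul0r.
  by rewrite si addKn (u2 (j + l - t)%N) ?mulr0 //; lia.
have ik : (i < (i + k).+1)%N by lia.
have jl : (j < (j + l).+1)%N by lia.
rewrite (bigD1 (Ordinal ik)) //= (bigD1 (Ordinal jl)) //= [X in _ + X + _]big1 => [|t tj];
  last by apply: (Z (Ordinal ik) t); rewrite -val_eqE in tj; rewrite tj orbT.
rewrite [X in _ + X]big1 ?addr0 => [|s si]; last first.
  by rewrite big1 // => t _; apply: (Z s t); rewrite -val_eqE in si; rewrite si.
by rewrite !addKn => /eqP; rewrite mulf_eq0 (negbTE pij) (negbTE ukl).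
Qed.

Definition ideal2 p q h := exists a b, h = a * p + b * q.

Lemma ideal2_subspace p q : subspace (@kc K) (ideal2 p q).
Proof.
split; first by exists 0, 0; rewrite !mul0r addr0.
- by move=> _ _ [a [b ->]] [c [d ->]]; exists (a + c), (b + d); ring.
- by move=> c _ [a [b ->]]; exists (kc c * a), (kc c * b); ring.
Qed.

Definition cofinite p q := exists N, ideal2 p q (xpow N) /\ ideal2 p q (ypow N).

(** Cofiniteness is carried along because it makes [q] a nonzero divisor modulo [p], on which
    additivity rests. *)
Definition idim p q n := qdim (@kc K) (ideal2 p q) n /\ cofinite p q.

Lemma idim_congr p q p' q' n :
  (forall h, ideal2 p q h <-> ideal2 p' q' h) -> idim p q n -> idim p' q' n.
Proof.
move=> E [D [N [/E xN /E yN]]]; split; last by exists N.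
exact: qdim_ext E D.
Qed.

Lemma idim_sym p q n : idim p q n -> idim q p n.
Proof.
by apply: idim_congr => h; split=> -[a [b ->]]; exists b, a; rewrite addrC.
Qed.

Lemma idim_addl p q a n : idim p (q + a * p) n -> idim p q n.
Proof.
apply: idim_congr => h; split=> -[c [b ->]].
  by exists (c + b * a), b; ring.
by exists (c - b * a), b; ring.
Qed.

Lemma idim_addr p q a n : idim p q n -> idim p (q + a * p) n.
Proof. by move=> H; apply: (@idim_addl _ _ (- a)); rewrite mulNr addrK. Qed.

Lemma idim_unitr p q v n : ev0 v != 0 -> idim p q n -> idim p (v * q) n.
Proof.
case/germ_unit => w vw; apply: idim_congr => h; split=> -[a [b ->]].
  by exists a, (b * w); transitivity (a * p + b * (v * w) * q); [rewrite vw mulr1 | ring].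
by exists a, (b * v); rewrite mulrA.
Qed.

(* If [q h] is a multiple of [p], so are [x^N h] and [y^N h] for some [N]. *)
Lemma cofinite_regular p q h a : p != 0 -> cofinite p q -> q * h = a * p ->
  exists w, h = w * p.
Proof.
move=> p0 [N [[c [d Ex]] [c' [d' Ey]]]] qh.
have xh : xpow N * h = p * (c * h + d * a).
  by rewrite Ex mulrDl -!mulrA qh; ring.
have yh : ypow N * h = p * (c' * h + d' * a).
  by rewrite Ey mulrDl -!mulrA qh; ring.
move: (c * h + d * a) (c' * h + d' * a) xh yh => u v xh yh.
(* From [y^N u = x^N v] the coefficients of [u] with [x]-exponent below [N] vanish. So [u = x^N w]
   with [w] a shift of [u], and cancelling [x^N] leaves [h = w p]. *)
have uv : ypow N * u = xpow N * v.
  apply/eqP; rewrite -subr_eq0; apply/eqP; apply: (germ_neq0_mulI p0).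
  by rewrite mulrBr mulrCA -xh [p * (_ * v)]mulrCA -yh mulrCA subrr.
have u_low i j : (i < N)%N -> u i j = 0.
  move=> iN; have E1 := ypowE N u i (j + N); have E2 := xpowE N v i (j + N).
  have Ni : (N <= i)%N = false by lia.
  by move: E1; rewrite uv E2 Ni leq_addl addnK mulr1n mulr0n.
have bnd : geom_bounded (PS (fun i => PS (fun j => u (i + N)%N j))).
  have [M [L [M0 L0 B]]] := germP u.
  exists (M * L ^+ N), L; split=> // [|i j /=].
    by rewrite mulr_ge0 ?exprn_ge0 // ltW.
  by rewrite -mulrA -exprD [(N + _)%N]addnC addnAC; apply: B.
pose w := mkgerm bnd.
have uw : u = xpow N * w.
  apply: germ_ext => i j; rewrite xpowE; case: leqP => Ni; last exact: u_low.
  by rewrite /= subnK.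
have x0 : xpow N != 0.
  apply/eqP => /(congr1 (fun a : germ K => a N 0%N))/eqP.
  by rewrite homE coefXn addn0 !eqxx oner_eq0.
exists w; apply/eqP; rewrite -subr_eq0; apply/eqP; apply: (germ_neq0_mulI x0).
by rewrite mulrBr xh uw; ring.
Qed.

(** Multiplication by [q1] embeds [R/(p, q2)] into [R/(p, q1 q2)] with cokernel [R/(p, q1)];
    injectivity is the regularity of [q1] modulo [p]. *)
Lemma idim_mul p q1 q2 n1 n2 : p != 0 ->
  idim p q1 n1 -> idim p q2 n2 -> idim p (q1 * q2) (n1 + n2).
Proof.
move=> p0 [D1 C1] [D2 C2]; split.
  rewrite addnC; apply: (qdim_exact (q := q1) _ _ _ D2 D1); first exact: ideal2_subspace.
    move=> h; split=> [[a [b ->]]|[a [b E]]]; first by exists (q1 * a), b; ring.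
    have [|w Ew] := @cofinite_regular p q1 (h - b * q2) a p0 C1.
      by rewrite mulrBr E; ring.
    by exists w, b; rewrite -Ew subrK.
  move=> h; split=> [[a [b ->]]|[k [a [b E]]]].
    by exists b, a, 0; ring.
  by exists a, (b * q2 + k); rewrite -[h](subrK (q1 * k)) E; ring.
case: C1 => N [[a [b Ex]] [c [d Ey]]]; case: C2 => M [[a' [b' Ex']] [c' [d' Ey']]].
exists (N + M)%N; split.
  by rewrite -xpowM Ex Ex'; exists (a * a' * p + a * b' * q2 + a' * b * q1), (b * b'); ring.
by rewrite -ypowM Ey Ey'; exists (c * c' * p + c * d' * q2 + c' * d * q1), (d * d'); ring.
Qed.

(** Finite colength passes to the larger ideal [(p, q2)], so additivity can be read backwards. This
    serves when a multiple of a derivative is easier to handle than the derivative. *)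
Lemma idim_cancel p q1 q2 n n1 : p != 0 ->
  idim p (q1 * q2) n -> idim p q1 n1 -> idim p q2 (n - n1).
Proof.
move=> p0 H H1.
have sub h : ideal2 p (q1 * q2) h -> ideal2 p q2 h.
  by move=> [a [b ->]]; exists a, (b * q1); rewrite mulrA.
have [m Dm] : exists m, qdim (@kc K) (ideal2 p q2) m.
  by apply: qdim_quot sub (H.1); apply: ideal2_subspace.
have H2 : idim p q2 m.
  by split=> //; have [N [/sub ? /sub ?]] := H.2; exists N.
have [D12 _] := idim_mul p0 H1 H2.
by rewrite (qdim_uniq (ideal2_subspace _ _) H.1 D12) addKn.
Qed.

Lemma idim_exp p q n k : p != 0 -> idim p q n -> idim p (q ^+ k) (k * n).
Proof.
move=> p0 H; elim: k => [|k IH]; last by rewrite exprS mulSn; apply: idim_mul.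
have U h : ideal2 p 1 h by exists 0, h; ring.
split; last by exists 0%N.
exists (fun=> 0); split=> [h|c _ []] //.
by exists (fun=> 0).
Qed.

Lemma idim_xy : idim (xpow 1%N) (ypow 1%N) 1.
Proof.
(* A germ without constant term is [x] times a shift plus [y] times a series in [y] alone. *)
have split_xy h : ordge 1%N h -> ideal2 (xpow 1%N) (ypow 1%N) h.
  move=> h0; have [M [L [M0 L0 B]]] := germP h.
  have b1 : geom_bounded (PS (fun i => PS (fun j => h i.+1 j))).
    exists (M * L), L; split=> // [|i j /=]; first by rewrite mulr_ge0 // ltW.
    by rewrite -mulrA -exprS -addSn; apply: B.
  have b2 : geom_bounded (PS (fun i => PS (fun j => h 0%N j.+1 *+ (i == 0%N)))).
    exists (M * L), L; split=> // [|i j /=]; first by rewrite mulr_ge0 // ltW.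
    case: i => [|i] /=; last by rewrite normr0 !mulr_ge0 ?exprn_ge0 // ltW.
    by rewrite mulr1n -mulrA -exprS; apply: B.
  exists (mkgerm b1), (mkgerm b2); apply: germ_ext => i j.
  rewrite germDE [mkgerm b1 * _]mulrC [mkgerm b2 * _]mulrC xpowE ypowE.
  case: i => [|i] /=; last by rewrite subn1 /= mulr0n mul0rn addr0.
  by case: j => [|j] /=; rewrite ?subn1 /= ?add0r // h0.
split.
  exists (fun=> 1); split=> [h|c [a [b]]].
    exists (fun=> ev0 h); apply: split_xy => -[|i] [|j] // _.
    by rewrite germBE /lincomb big_ord1 mulr1 kcE subrr.
  rewrite /lincomb big_ord1 mulr1 => /(congr1 (@ev0 K)).
  rewrite !(rmorphD, rmorphM) /= {1}/ev0 kcE /ev0 !homE /= coef1 coefX /= !mulr0 addr0.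
  by move=> c0 t; rewrite ord1.
by exists 1%N; split; apply: split_xy; apply: hom_ordge.
Qed.
End Forms.

(** * Initial forms and the product formula *)

Section InitialForms.
Variable K : numClosedFieldType.
Implicit Types (p q h : germ K) (P Q H : {poly K}).

(* Restated on germs: unification must not unfold the ring operations of germs. *)
Lemma gordgeD n p q : ordge n p -> ordge n q -> ordge n (p + q).
Proof. exact: (@ordgeD _ n p q). Qed.
Lemma gordgeN n p : ordge n p -> ordge n (- p).
Proof. exact: (@ordgeN _ n p). Qed.
Lemma gordgeB n p q : ordge n p -> ordge n q -> ordge n (p - q).
Proof. exact: (@ordgeB _ n p q). Qed.
Lemma gordgeM n m p q : ordge n p -> ordge m q -> ordge (n + m)%N (p * q).
Proof. exact: (@ordgeM _ n m p q). Qed.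
Lemma gordgeMl n p q : ordge n q -> ordge n (p * q).
Proof. exact: (@ordgeMl _ n p q). Qed.

Lemma ideal2M p q a h : ideal2 p q h -> ideal2 p q (a * h).
Proof. by move=> [b [c ->]]; exists (a * b), (a * c); ring. Qed.
Lemma ideal2D p q h h' : ideal2 p q h -> ideal2 p q h' -> ideal2 p q (h + h').
Proof. by case: (ideal2_subspace p q) => _ H _; apply: H. Qed.
Lemma ideal2_sum p q (I : Type) (r : seq I) (F : I -> germ K) :
  (forall i, ideal2 p q (F i)) -> ideal2 p q (\sum_(i <- r) F i).
Proof.
move=> HF; elim/big_ind: _ => [||i _] //; last exact: ideal2D.
by exists 0, 0; ring.
Qed.

(** Each monomial [x^k y^l] of degree at least [N] is charged to one generator: to [x^k y^(N-k)] if
    [k < N], to [x^N] otherwise. If all degrees exceed [N], the cofactors have no constant term. *)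
Lemma ordge_gen N h : ordge N h -> exists c : 'I_N.+1 -> germ K,
  h = \sum_i c i * hom N 'X^i /\ (ordge N.+1 h -> forall i, ev0 (c i) = 0).
Proof.
move=> oh; have [M [L [M0 L0 B]]] := germP h.
pose s (t : 'I_N.+1) := PS (fun k => PS (fun l =>
  h (t + k)%N (N - t + l)%N *+ ((k == 0%N) || (t == N :> nat)))) : ps (ps K).
have sb t : geom_bounded (s t).
  exists (M * L ^+ N), L; split=> // [|i j]; first by rewrite mulr_ge0 ?exprn_ge0 // ltW.
  rewrite /s /=; case: (_ || _); last first.
    by rewrite normr0 !mulr_ge0 ?exprn_ge0 // ltW.
  rewrite mulr1n; apply: (le_trans (B _ _)); rewrite -mulrA -exprD.
  by rewrite (_ : t + i + (N - t + j) = N + (i + j))%N //; have := ltn_ord t; lia.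
exists (fun t => mkgerm (sb t)); split=> [|oh' i]; last first.
  rewrite /ev0 /= !addn0 oh' //; have := ltn_ord i; lia.
apply: germ_ext => k l; rewrite germ_sumE.
have E (t : 'I_N.+1) : (mkgerm (sb t) * hom N 'X^t) k l =
    h (t + (k - t))%N (N - t + (l - (N - t)))%N
      *+ ((k - t == 0)%N || (t == N :> nat)) *+ ((t <= k) && (N - t <= l))%N.
  by rewrite mulrC homXE // -ltnS.
under eq_bigr => t _ do rewrite E.
have [Nk|kN] := leqP N k.
  rewrite (bigD1 ord_max) //= eqxx orbT subnn subn0 Nk subnKC // big1 ?addr0 // => t tN.
  have /eqP tN' : (t : nat) != N by rewrite -val_eqE in tN.
  have := ltn_ord t => tl.
  by rewrite (_ : (k - t == 0)%N = false) ?(introF eqP tN') ?mulr0n ?mul0rn //; apply/eqP; lia.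
have kN' : (k < N.+1)%N by lia.
rewrite (bigD1 (Ordinal kN')) //= subnn eqxx leqnn /= addn0 big1 ?addr0 => [|t tk].
  have [H|H] := leqP (N - k) l; first by rewrite subnKC.
  by rewrite mulr0n oh //; lia.
have /eqP tk' : (t : nat) != k by rewrite -val_eqE in tk.
have := ltn_ord t => tl.
have [H|H] := leqP t k; last by rewrite mulr0n.
have -> : (k - t == 0)%N = false by apply/eqP; lia.
have -> : (t == N :> nat) = false by apply/eqP; lia.
by rewrite mul0rn.
Qed.

(* Nakayama's lemma for the module of germs of order at least [N]. *)
Lemma ordge_nakayama p q N :
    (forall h, ordge N h -> exists h' : germ K, ordge N.+1 h' /\ ideal2 p q (h - h')) ->
  forall h, ordge N h -> ideal2 p q h.
Proof.
move=> step.
have /choice [h' Hh'] : forall i : 'I_N.+1, exists h' : germ K,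
  ordge N.+1 h' /\ ideal2 p q (hom N 'X^i - h').
  by move=> i; apply: step; apply: hom_ordge.
have /choice [c Hc] i := ordge_gen (ordgeW (leqnSn N) (Hh' i).1).
(* The matrix [c] vanishes at 0, so [A] is the identity there and [det A] is a unit; the adjugate
   then puts every monomial of degree [N] into the ideal. *)
pose A : 'M[germ K]_N.+1 := 1%:M - \matrix_(i, j) c i j.
pose v : 'cV[germ K]_N.+1 := \col_i hom N 'X^i.
have Av i : ideal2 p q ((A *m v) i 0).
  rewrite mulmxBl mul1mx !mxE; under eq_bigr do rewrite !mxE.
  by rewrite -(Hc i).1; apply: (Hh' i).2.
have [w dw] : exists w, \det A * w = 1.
  apply: germ_unit; rewrite -det_map_mx (_ : map_mx _ A = 1%:M) ?det1 ?oner_neq0 //.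
  apply/matrixP => i j; rewrite !mxE rmorphB /= (Hc i).2 ?subr0; last exact: (Hh' i).1.
  by case: (i == j); rewrite ?rmorph1 ?rmorph0.
have gen i : ideal2 p q (hom N 'X^i : germ K) \/ (N < i)%N.
  case: (ltnP N i) => [|iN]; [by right | left].
  rewrite -ltnS in iN.
  have -> : hom N 'X^i = w * (\adj A *m (A *m v)) (Ordinal iN) 0.
    rewrite mulmxA mul_adj_mx mul_scalar_mx !mxE /= mulrA [w * _]mulrC dw mul1r //.
  by apply: ideal2M; rewrite mxE; apply: ideal2_sum => j; apply: ideal2M.
move=> h /ordge_gen[d [-> _]]; apply: ideal2_sum => i; apply: ideal2M.
by have [|] := gen i => //; have := ltn_ord i; lia.
Qed.

(** [P] may be zero, in which case [p] has order at least [a + 1]; sums whose initial forms cancel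
    are thus included. *)
Definition isform a P p := ordge a.+1 (p - hom a P).

Lemma isform_ordge a P p : isform a P p -> ordge a p.
Proof.
move=> H; rewrite -[germ_val p]/(val p) -[p](subrK (hom a P)); apply: gordgeD.
  exact: ordgeW H.
exact: hom_ordge.
Qed.

Lemma isformM a b P Q p q : (size P <= a.+1)%N -> (size Q <= b.+1)%N ->
  isform a P p -> isform b Q q -> isform (a + b)%N (P * Q) (p * q).
Proof.
move=> sP sQ Hp Hq; rewrite /isform -homM //.
have -> : p * q - hom a P * hom b Q = (p - hom a P) * q + hom a P * (q - hom b Q).
  by ring.
apply: gordgeD; first by rewrite -addSn; apply: gordgeM Hp (isform_ordge Hq).
by rewrite -addnS; apply: gordgeM Hq; apply: hom_ordge.
Qed.

Lemma isform_uniq n P Q p q : (size P <= n.+1)%N -> (size Q <= n.+1)%N ->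
  isform n P p -> isform n Q q -> ordge n.+1 (p - q) -> P = Q.
Proof.
move=> sP sQ Hp Hq Hpq; apply/eqP; rewrite -subr_eq0; apply/eqP.
apply: (@hom_ordgeS_eq0 _ n).
  by apply: leq_trans (size_polyD _ _) _; rewrite size_polyN geq_max sP.
have -> : hom n (P - Q) = (p - q) - (p - hom n P) + (q - hom n Q).
  by rewrite homB; ring.
by apply: gordgeD => //; apply: gordgeB.
Qed.

Definition lead n h : {poly K} := \poly_(i < n.+1) h i (n - i)%N.
Lemma size_lead n h : (size (lead n h) <= n.+1)%N. Proof. exact: size_poly. Qed.
Lemma lead_isform n h : ordge n h -> isform n (lead n h) h.
Proof. exact: hom_lead. Qed.

(** Bezout with degree control: the cofactor of [Q] is reduced modulo [P], and the equation then
    forces the degree of the other. The result can be read as an identity of forms of degree [n]. *)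
Lemma coprimep_combine a b n P Q H : coprimep P Q ->
    size P = a.+1 -> (size Q <= b.+1)%N -> (a + b <= n)%N -> (size H <= n.+1)%N ->
  exists U V, [/\ H = U * P + V * Q, (size U <= (n - a).+1)%N & (size V <= (n - b).+1)%N].
Proof.
move=> /Bezout_eq1_coprimepP[[u v] /= uv] sP sQ abn sH.
have P0 : P != 0 by rewrite -size_poly_eq0 sP.
pose V : {poly K} := (H * v) %% P; pose U : {poly K} := H * u + (H * v) %/ P * Q.
have E : H = U * P + V * Q.
  rewrite -[LHS]mulr1 -uv mulrDr [H * (v * Q)]mulrA {1}(divp_eq (H * v) P) /U /V.
  by ring.
have sV : (size V <= a)%N by rewrite -ltnS -sP ltn_modp.
exists U, V; split=> //; last by apply: leq_trans sV _; lia.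
have [->|U0] := eqVneq U 0; first by rewrite size_poly0.
have : (size (U * P)%R <= n.+1)%N.
  have -> : U * P = H - V * Q by rewrite E addrK.
  apply: leq_trans (size_polyD _ _) _; rewrite geq_max sH size_polyN.
  apply: leq_trans (size_polyMleq _ _) _.
  by move: sV sQ; move: (size V) (size (polyseq Q)) => x y; lia.
rewrite size_mul // sP; move: (size (polyseq U)) => x; lia.
Qed.

Section TwoForms.
Variables (a b : nat) (P Q : {poly K}) (p q : germ K).
Hypotheses (Hp : isform a P p) (Hq : isform b Q q) (PQ : coprimep P Q).
Hypotheses (sP : size P = a.+1) (sQ : (size Q <= b.+1)%N).

(** Coprime forms of degrees [a] and [b] generate all forms of degree [a + b], so modulo [(p, q)]
    the order can be raised by one. The exact size of [P] says that [y] does not divide the form of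
    [p]; this is what makes coprime polynomials homogenize to coprime forms. *)
Lemma ordge_ideal2 h : ordge (a + b)%N h -> ideal2 p q h.
Proof.
apply: ordge_nakayama => {}h oh; set N := (a + b)%N in oh *.
have [U [V [E sU sV]]] := coprimep_combine PQ sP sQ (leqnn N) (size_lead N h).
exists (h - hom (N - a)%N U * p - hom (N - b)%N V * q); split; last first.
  by exists (hom (N - a)%N U), (hom (N - b)%N V); ring.
have -> : h - hom (N - a)%N U * p - hom (N - b)%N V * q =
    (h - hom N (lead N h)) - hom (N - a)%N U * (p - hom a P) - hom (N - b)%N V * (q - hom b Q).
  rewrite E homD -[N in hom N (U * P)](subnK (leq_addr b a)).
  rewrite -[N in hom N (V * Q)](subnK (leq_addl a b)) -!homM ?sP //.
  by ring.
apply: gordgeB; first apply: gordgeB; first exact: lead_isform.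
  rewrite (_ : N.+1 = N - a + a.+1)%N; last by rewrite /N; lia.
  by apply: gordgeM Hp; apply: hom_ordge.
rewrite (_ : N.+1 = N - b + b.+1)%N; last by rewrite /N; lia.
by apply: gordgeM Hq; apply: hom_ordge.
Qed.

Lemma two_forms_cofinite : cofinite p q.
Proof. by exists (a + b)%N; split; apply: ordge_ideal2; apply: hom_ordge. Qed.

(** Comparing initial forms in [q h] and [u p] gives [Q H = A P]. By coprimality [P] divides the
    form [H] of [h], and subtracting a multiple of [p] removes it. *)
Lemma coprime_form_step k h (u : germ K) : ordge k h -> ordge (k + b).+1%N (q * h - u * p) ->
  exists w : germ K, ordge k.+1 (h - w * p).
Proof.
move=> oh oqh; have Hh := lead_isform oh; set H := lead k h in Hh.
have P0 : P != 0 by rewrite -size_poly_eq0 sP.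
have Hqh : isform (b + k)%N (Q * H) (q * h) by apply: isformM => //; apply: size_lead.
have sQH : (size (Q * H)%R <= (b + k).+1)%N.
  apply: leq_trans (size_polyMleq _ _) _; have := size_lead k h; rewrite -/H.
  by move: sQ; move: (size (polyseq H)) (size (polyseq Q)) => x y; lia.
have up : ordge (k + b)%N (u * p).
  have -> : u * p = q * h - (q * h - u * p) by ring.
  apply: gordgeB; last exact: ordgeW oqh.
  by rewrite addnC; apply: isform_ordge Hqh.
(* As [u p] has order at least [k + b] and [P] is nonzero, [u] has order at least [k + b - a]; for
   [a > k + b] the subtraction yields 0 and nothing is claimed. *)
have ou j : (j <= k + b - a)%N -> ordge j u.
  elim: j => [|j IH] jk; first exact: ordge_0.
  have {}IH := lead_isform (IH (ltnW jk)).
  have Hup : isform (j + a)%N (lead j u * P) (u * p).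
    by apply: isformM IH Hp => //; rewrite ?size_lead // sP.
  have : lead j u * P = 0.
    apply: (isform_uniq (n := j + a) (p := u * p) (q := 0)) => //.
    - apply: leq_trans (size_polyMleq _ _) _; rewrite sP.
      by have := size_lead j u; move: (size (polyseq _)) => x; lia.
    - by rewrite size_poly0.
    - by rewrite /isform hom0 subr0.
    - by rewrite subr0; apply: ordgeW up; lia.
  move/eqP; rewrite mulf_eq0 (negbTE P0) orbF => /eqP u0.
  by move: IH; rewrite /isform u0 hom0 subr0.
(* If [a > k + b], then [u p] starts too late to contribute and [Q H = 0]. *)
have [A AP] : exists A, Q * H = A * P.
  have [ak|ka] := leqP a (k + b).
    have {}ou := ou _ (leqnn _); exists (lead (k + b - a)%N u).
    apply: (isform_uniq (n := b + k) (p := q * h) (q := u * p)) => //.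
    - apply: leq_trans (size_polyMleq _ _) _; rewrite sP.
      by have := size_lead (k + b - a)%N u; move: (size (polyseq _)) => x; lia.
    - rewrite (_ : b + k = k + b - a + a)%N; last by lia.
      by apply: isformM (lead_isform ou) Hp => //; rewrite ?size_lead // sP.
    - by rewrite addnC.
  exists 0; rewrite mul0r.
  apply: (isform_uniq (n := b + k) (p := q * h) (q := 0)) => //.
  - by rewrite size_poly0.
  - by rewrite /isform hom0 subr0.
  - rewrite subr0 -[q * h](subrK (u * p)); apply: gordgeD; first by rewrite addnC.
    by apply: gordgeMl; apply: ordgeW (isform_ordge Hp); lia.
have /dvdpP[W HW] : P %| H by rewrite -(Gauss_dvdpr _ PQ) AP dvdp_mull.
have [W0|W0] := eqVneq W 0.
  by exists 0; move: Hh; rewrite /isform HW W0 !mul0r hom0 !subr0.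
have sW : (size W + a <= k.+1)%N.
  have := size_lead k h; rewrite -/H HW size_mul // sP.
  by move: (size (polyseq W)) => x; lia.
have Wp : (0 < size W)%N by rewrite size_poly_gt0.
have ka : (a <= k)%N by move: sW Wp; move: (size (polyseq W)) => x; lia.
exists (hom (k - a)%N W).
have -> : h - hom (k - a)%N W * p = (h - hom k H) - hom (k - a)%N W * (p - hom a P).
  rewrite HW -[k in hom k (W * P)](subnK ka) -homM ?sP //; first by ring.
  by move: sW; move: (size (polyseq W)) => x; lia.
apply: gordgeB => //; rewrite (_ : k.+1 = k - a + a.+1)%N; last by lia.
by apply: gordgeM Hp; apply: hom_ordge.
Qed.

(** The ideal [(p) + m^n]. *)
Definition truncated_ideal n h := exists w : germ K, ordge n (h - w * p).

Lemma truncated_ideal_subspace n : subspace (@kc K) (truncated_ideal n).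
Proof.
split; first by exists 0; rewrite mul0r subr0.
- move=> h h' [w Hw] [w' Hw']; exists (w + w').
  have -> : h + h' - (w + w') * p = (h - w * p) + (h' - w' * p) by ring.
  exact: (gordgeD Hw Hw').
- move=> c h [w Hw]; exists (kc c * w).
  have -> : kc c * h - kc c * w * p = kc c * (h - w * p) by ring.
  exact: (gordgeMl _ Hw).
Qed.

Lemma truncated_ideal_mul n h : truncated_ideal n h <-> truncated_ideal (n + b)%N (q * h).
Proof.
split=> [[w Hw]|[u Hu]].
  exists (q * w); have -> : q * h - q * w * p = q * (h - w * p) by ring.
  by rewrite addnC; apply: gordgeM Hw; apply: isform_ordge Hq.
(* The order of [h] modulo [p] is raised one step at a time; replacing [h] by [h - w p] changes the
   multiplier [u] to [u - q w]. *)
suff: forall k, (k <= n)%N -> truncated_ideal k h by apply.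
elim=> [|k IH] kn; first by exists 0; apply: ordge_0.
have [w Hw] := IH (ltnW kn).
have [|w' Hw'] := @coprime_form_step k (h - w * p) (u - q * w) Hw.
  have -> : q * (h - w * p) - (u - q * w) * p = q * h - u * p by ring.
  by apply: ordgeW Hu; lia.
exists (w + w'); have -> // : h - (w + w') * p = h - w * p - w' * p by ring.
Qed.

(** Starting from [m^a] is enough: [m^(a+b)] already lies in [(p, q)], so the cokernel of
    multiplication by [q] is [R/(p, q)]. *)
Lemma truncated_ideal_exact n1 n2 : qdim (@kc K) (truncated_ideal a) n1 ->
  qdim (@kc K) (ideal2 p q) n2 -> qdim (@kc K) (truncated_ideal (a + b)%N) (n1 + n2).
Proof.
apply: (qdim_exact (q := q)); first exact: truncated_ideal_subspace.
  exact: truncated_ideal_mul.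
move=> h; split=> [[u [v ->]]|[k [w Hw]]].
  exists v, u; have -> : u * p + v * q - q * v - u * p = 0 by ring.
  exact: ordge0.
have [u [v E]] := ordge_ideal2 Hw; exists (w + u), (k + v).
by rewrite -[h](subrK (q * k)) -[h - q * k](subrK (w * p)) E; ring.
Qed.
End TwoForms.

Lemma xpow_exp n : xpow K n = xpow K 1%N ^+ n.
Proof.
elim: n => [|n IH]; last by rewrite exprS -IH xpowM.
by rewrite /xpow !expr0 hom_kc rmorph1.
Qed.
Lemma ypow_exp n : ypow K n = ypow K 1%N ^+ n.
Proof.
elim: n => [|n IH]; last by rewrite exprS -IH ypowM.
by rewrite /ypow expr0 hom_kc rmorph1.
Qed.
Lemma xpow_neq0 n : xpow K n != 0.
Proof.
apply/eqP => /(congr1 (fun a : germ K => a n 0%N))/eqP.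
by rewrite homE coefXn addn0 !eqxx oner_eq0.
Qed.
Lemma ypow_neq0 n : ypow K n != 0.
Proof.
apply/eqP => /(congr1 (fun a : germ K => a 0%N n))/eqP.
by rewrite homE coef1 add0n !eqxx oner_eq0.
Qed.

Lemma idim_y_xpow n : idim (ypow K 1%N) (xpow K n) n.
Proof.
rewrite xpow_exp -[X in idim _ _ X]muln1; apply: idim_exp; first exact: ypow_neq0.
by apply: idim_sym; apply: idim_xy.
Qed.

Lemma qdim_ordge_sup n (J : germ K -> Prop) : subspace (@kc K) J ->
  (forall h, ordge n h -> J h) -> exists m, qdim (@kc K) J m.
Proof.
move=> sJ oJ.
have D : idim (xpow K n) (ypow K n) (n * n).
  rewrite ypow_exp; apply: idim_exp; first exact: xpow_neq0.
  by apply: idim_sym; apply: idim_y_xpow.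
apply: qdim_quot sJ _ D.1 => h [a [b ->]]; apply: oJ.
by apply: gordgeD; apply: gordgeMl; apply: hom_ordge.
Qed.

(** Modulo [y], [p] is a series in [x] whose lowest term is a nonzero multiple of [x^a] because
    [size P = a.+1]; that is, a unit times [x^a]. *)
Lemma idim_ypow1 a P p : isform a P p -> size P = a.+1 -> idim (ypow K 1%N) p a.
Proof.
move=> Hp sP; have op := isform_ordge Hp.
have [M [L [M0 L0 B]]] := germP p.
have b1 : geom_bounded (PS (fun i => PS (fun j => p (i + a)%N 0%N *+ (j == 0%N)))).
  exists (M * L ^+ a), L; split=> // [|i j /=]; first by rewrite mulr_ge0 ?exprn_ge0 // ltW.
  case: j => [|j] /=; last by rewrite normr0 !mulr_ge0 ?exprn_ge0 // ltW.
  by rewrite mulr1n -mulrA -exprD addn0 [(a + i)%N]addnC; have := B (i + a)%N 0%N; rewrite addn0.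
have b2 : geom_bounded (PS (fun i => PS (fun j => p i j.+1))).
  exists (M * L), L; split=> // [|i j /=]; first by rewrite mulr_ge0 // ltW.
  by rewrite -mulrA -exprS -addnS; apply: B.
have E : p = mkgerm b1 * xpow K a + mkgerm b2 * ypow K 1%N.
  apply: germ_ext => i j; rewrite germDE [mkgerm b1 * _]mulrC [mkgerm b2 * _]mulrC.
  rewrite xpowE ypowE; case: j => [|j] /=.
    case: leqP => ai; first by rewrite subnK // mulr1n addr0.
    by rewrite add0r op //; lia.
  by rewrite subn1 /= mulr0n mul0rn add0r.
rewrite E; apply: idim_addr; apply: idim_unitr; last exact: idim_y_xpow.
rewrite /ev0 /= add0n; have := Hp a 0%N; rewrite germBE homE addn0 eqxx mulr1n => /(_ (leqnn _)).
move/eqP; rewrite subr_eq0 => /eqP ->.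
have -> : P`_a = lead_coef P by rewrite lead_coefE sP.
by rewrite lead_coef_eq0 -size_poly_eq0 sP.
Qed.

Lemma isform_neq0 a P p : isform a P p -> (size P <= a.+1)%N -> P != 0 -> p != 0.
Proof.
move=> Hp sP; apply: contra => /eqP p0; apply/eqP; apply: (@hom_ordgeS_eq0 _ a) => //.
have -> : hom a P = - (p - hom a P) by rewrite p0; ring.
exact: gordgeN.
Qed.

(** The dimension of [R/((p) + m^a)], whatever it is, cancels between the exact sequences for [q]
    and for [y^b]. The form of [y^b] dehomogenizes to 1, which is coprime to [P]. *)
Theorem idim_forms a b P Q p q : isform a P p -> isform b Q q ->
  coprimep P Q -> size P = a.+1 -> (size Q <= b.+1)%N -> idim p q (a * b).
Proof.
move=> Hp Hq PQ sP sQ; split; last exact: two_forms_cofinite Hp Hq PQ sP sQ.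
have Hy : isform b 1 (ypow K b) by rewrite /isform subrr.
have Py : coprimep P 1 by rewrite coprimep1.
have sy : (size (1%R : {poly K}) <= b.+1)%N by rewrite size_poly1.
have [m Dm] : exists m, qdim (@kc K) (truncated_ideal p a) m.
  apply: (@qdim_ordge_sup a); first exact: truncated_ideal_subspace.
  by move=> h oh; exists 0; rewrite mul0r subr0.
have [n Dn] : exists n, qdim (@kc K) (ideal2 p q) n.
  apply: (@qdim_ordge_sup (a + b)%N); first exact: ideal2_subspace.
  exact: ordge_ideal2 Hp Hq PQ sP sQ.
have D := truncated_ideal_exact Hp Hq PQ sP sQ Dm Dn.
have [D' _] : idim p (ypow K b) (b * a).
  rewrite ypow_exp; apply: idim_exp.
    by apply: isform_neq0 Hp _ _; rewrite -?size_poly_eq0 sP.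
  by apply: idim_sym; apply: idim_ypow1 Hp sP.
have D'' := truncated_ideal_exact Hp Hy Py sP sy Dm D'.
have /eqP := qdim_uniq (truncated_ideal_subspace p (a + b)%N) D D''.
by rewrite eqn_add2l mulnC => /eqP <-.
Qed.
End InitialForms.

(** * Colengths for the three families *)

Section Families.
Variable K : numClosedFieldType.
Implicit Types (P Q R A : {poly K}) (p q h gx gy G : germ K).

Lemma isformD n P Q p q : isform n P p -> isform n Q q -> isform n (P + Q) (p + q).
Proof.
move=> Hp Hq; rewrite /isform homD.
have -> : p + q - (hom n P + hom n Q) = (p - hom n P) + (q - hom n Q) by ring.
exact: gordgeD Hp Hq.
Qed.
Lemma isformN n P p : isform n P p -> isform n (- P) (- p).
Proof.
move=> Hp; rewrite /isform homN.
have -> : - p - - hom n P = - (p - hom n P) by ring.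
exact: gordgeN Hp.
Qed.
Lemma isformB n P Q p q : isform n P p -> isform n Q q -> isform n (P - Q) (p - q).
Proof. by move=> Hp Hq; apply: isformD => //; apply: isformN. Qed.
Lemma isform_hom n P : isform n P (hom n P).
Proof. by rewrite /isform subrr; apply: ordge0. Qed.
Lemma isform_ordgeS n p : ordge n.+1 p -> isform n 0 p.
Proof. by rewrite /isform hom0 subr0. Qed.
Lemma isform_addS n P p q : isform n P p -> ordge n.+1 q -> isform n P (p + q).
Proof. by move=> Hp Hq; rewrite -[P]addr0; apply: isformD => //; apply: isform_ordgeS. Qed.

Variable rho : K.
(** The linear form [X] at [y = 1]; thus [hom n (u ^+ k)] is [X^k Y^(n-k)] for [k <= n]. *)
Let u : {poly K} := 'X - rho%:P.

Lemma u_size k : size (u ^+ k) = k.+1. Proof. exact: size_exp_XsubC. Qed.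
Lemma u_neq0 k : u ^+ k != 0. Proof. by rewrite expf_neq0 // polyXsubC_eq0. Qed.
Lemma u_root : u.[rho] = 0. Proof. by rewrite hornerXsubC subrr. Qed.

Lemma coprimep_u k P : P.[rho] != 0 -> coprimep (u ^+ k) P.
Proof. by move=> P0; apply: coprimep_expl; rewrite coprimep_sym coprimep_XsubC. Qed.

Lemma size_uZ c k : c != 0 -> size (c *: u ^+ k) = k.+1.
Proof. by move=> c0; rewrite size_scale // u_size. Qed.

(** In [H = A g_Y - b X g_X] the lowest parts cancel. The next form [Z = A R - b u Q] equals [A R]
    at [rho] and [- b u Q] modulo [A], hence is coprime to both factors of [u^c A]. Modulo [g_X],
    [H] is [A g_Y]; modulo [A], [g_X] is [gx1], whose form [Q] gives the correction [b (h+1)]. *)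
Lemma milnor_family_A c b A Q R (s : K) gx gy gx1 gy1 :
    let h := (c + b)%N in
    s != 0 -> size A = b.+1 -> A.[rho] != 0 -> coprimep A Q -> R.[rho] != 0 ->
    (size Q <= h.+2)%N -> (size R <= h.+2)%N ->
    isform h.+1 Q gx1 -> isform h.+1 R gy1 ->
    gx = hom h (s *: (u ^+ c * A)) + gx1 -> gy = hom h ((s * b%:R) *: u ^+ c.+1) + gy1 ->
  idim gx gy (h * (b + h.+1) - b * h.+1).
Proof.
move=> h s0 sA A0 AQ R0 sQ sR Hx Hy Egx Egy.
have A_neq0 : A != 0 by rewrite -size_poly_eq0 sA.
pose P := s *: (u ^+ c * A).
have sP : size P = h.+1.
  by rewrite size_scale // size_mul ?u_neq0 // u_size sA addSn addnS.
have Hgx : isform h P gx.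
  by rewrite Egx; apply: isform_addS; [apply: isform_hom | apply: isform_ordge Hx].
have gx0 : gx != 0 by apply: isform_neq0 Hgx _ _; rewrite -?size_poly_eq0 sP.
pose B := b%:R *: u.
have sB : (size B <= b.+1)%N.
  rewrite /B; case: (b) => [|b']; first by rewrite scale0r size_poly0.
  by rewrite size_scale ?pnatr_eq0 // size_XsubC.
pose H := hom b A * gy1 - hom b B * gx1.
have EH : H = hom b A * gy + (- hom b B) * gx.
  rewrite /H Egx Egy.
  have E : hom b A * hom h ((s * b%:R) *: u ^+ c.+1) = hom b B * hom h P.
    have sh : (size ((s * b%:R) *: u ^+ c.+1) <= h.+1)%N.
      case: (posnP b) => [->|b0]; first by rewrite mulr0 scale0r size_poly0.
      by apply: leq_trans (size_scale_leq _ _) _; rewrite u_size /h; lia.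
    rewrite !homM ?sA ?sP //; congr (hom _ _).
    by rewrite /B /P -!mul_polyC polyCM exprS; ring.
  by rewrite mulNr !mulrDr E; ring.
pose Z := A * R - B * Q.
have HZ : isform (b + h.+1)%N Z H.
  by apply: isformB; apply: isformM; rewrite ?sA //; apply: isform_hom.
have Z0 : Z.[rho] != 0.
  by rewrite /Z /B hornerD hornerN !hornerM hornerZ u_root mulr0 mul0r subr0 mulf_neq0.
have sZ : (size Z <= (b + h.+1).+1)%N.
  apply: leq_trans (size_polyD _ _) _; rewrite geq_max size_polyN; apply/andP; split.
    apply: leq_trans (size_polyMleq _ _) _; rewrite sA.
    by move: sR; move: (size (polyseq R)) => x; lia.
  apply: leq_trans (size_polyMleq _ _) _.
  by move: sB sQ; move: (size (polyseq B)) (size (polyseq Q)) => x y; lia.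
have PZ : coprimep P Z.
  rewrite coprimepZl // coprimepMl coprimep_u //=.
  rewrite /Z [A * R]mulrC coprimep_addl_mul -mulNr coprimepMr AQ andbT /B -scaleNr.
  case: (posnP b) => [b0|b0].
    have /size_poly1P[e e0 ->] : size A == 1%N by rewrite sA b0.
    by rewrite -alg_polyC coprimepZl // coprime1p.
  rewrite coprimepZr ?oppr_eq0 ?pnatr_eq0 -?lt0n //.
  by rewrite coprimep_sym -[u]expr1 coprimep_u.
have D1 : idim gx (hom b A * gy) (h * (b + h.+1)).
  by apply: (@idim_addl _ _ _ (- hom b B)); rewrite -EH; apply: idim_forms Hgx HZ PZ sP sZ.
apply: idim_cancel D1 _ => //; apply: idim_sym.
have -> : gx = gx1 + (kc s * hom c (u ^+ c)) * hom b A.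
  by rewrite Egx homZ -mulrA homM ?u_size ?sA // addrC.
exact: (idim_addr _ (idim_forms (@isform_hom b A) Hx AQ sA sQ)).
Qed.

Lemma idim_u n P p : isform n P p -> (size P <= n.+1)%N -> P.[rho] != 0 ->
  idim p (hom 1%N u) n.
Proof.
move=> Hp sP P0; apply: idim_sym; rewrite -[X in idim _ _ X]mul1n.
apply: (idim_forms (@isform_hom 1%N u) Hp) => //; last by rewrite size_XsubC.
by rewrite -[u]expr1 coprimep_u.
Qed.

(** Modulo [X] only [gx1] survives in [g_X], which contributes [h + 2]. The other factor [G] has a
    form not divisible by [X], while that of [g_X] is a power of [X]. *)
Lemma milnor_family_C (h : nat) Q R (c : K) gx gy gx1 G :
    c != 0 -> Q.[rho] != 0 -> (size Q <= h.+3)%N -> R.[rho] != 0 -> (size R <= h.+2)%N ->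
    isform h.+2 Q gx1 -> isform h.+1 R G ->
    gx = hom h.+1 (c *: u ^+ h.+1) + gx1 -> gy = hom 1%N u * G ->
  idim gx gy (h.+2 + h.+1 * h.+1).
Proof.
move=> c0 Q0 sQ R0 sR HQ HR Egx ->.
have sP := size_uZ h.+1 c0.
have Hgx : isform h.+1 (c *: u ^+ h.+1) gx.
  by rewrite Egx; apply: isform_addS; [apply: isform_hom | apply: isform_ordge HQ].
have gx0 : gx != 0 by apply: isform_neq0 Hgx _ _; rewrite -?size_poly_eq0 sP.
apply: idim_mul => //; last first.
  by apply: idim_forms Hgx HR _ sP sR; rewrite coprimepZl // coprimep_u.
apply: idim_sym.
have -> : gx = gx1 + (hom h (c *: u ^+ h)) * hom 1%N u.
  rewrite Egx homM ?size_uZ ?size_XsubC // addn1 -scalerAl -exprSr addrC //.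
by apply: idim_addr; apply: idim_sym; apply: idim_u HQ sQ Q0.
Qed.

(** After [X] is split off from [g_Y], the initial forms of [g_X] and [G] are multiples of
    [X^(a+1) Y^(b+1)] and [X^(a+1) Y^b]. Two successive cancellations are required to reach a form
    coprime to that of [g_X]. *)
Lemma milnor_family_B a b Q R (s : K) gx gy gx2 G G2 :
    let m := (a + b).+3 in
    s != 0 -> Q.[rho] != 0 -> a.+2%:R * R.[rho] - b.+1%:R * Q.[rho] != 0 ->
    (size Q <= m.+2)%N -> (size R <= m.+1)%N ->
    isform m.+1 Q gx2 -> isform m R G2 ->
    gx = hom (a + b).+2%N ((s * a.+2%:R) *: u ^+ a.+1)
         + hom m ((s * m.+1%:R) *: u ^+ m) + gx2 ->
    G = hom (a + b).+1%N ((s * b.+1%:R) *: u ^+ a.+1) + G2 -> gy = hom 1%N u * G ->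
  idim gx gy (m.+1 + ((m + b.+2) * (a + b).+2 - b.+2 * m)).
Proof.
move=> m s0 Q0 RQ sQ sR HQ HR Egx EG ->.
have a0 : a.+2%:R != 0 :> K by rewrite pnatr_eq0.
have b0 : b.+1%:R != 0 :> K by rewrite pnatr_eq0.
have m0 : m.+1%:R != 0 :> K by rewrite pnatr_eq0.
have sa0 : s * a.+2%:R != 0 by rewrite mulf_neq0.
have sm0 : s * m.+1%:R != 0 by rewrite mulf_neq0.
pose P := (s * a.+2%:R) *: u ^+ a.+1.
have sP : (size P <= (a + b).+3)%N by rewrite size_uZ // /m; lia.
pose gx1 := hom m ((s * m.+1%:R) *: u ^+ m) + gx2.
have Hgx1 : isform m ((s * m.+1%:R) *: u ^+ m) gx1.
  by apply: isform_addS; [apply: isform_hom | apply: isform_ordge HQ].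
have Egx1 : gx = hom (a + b).+2%N P + gx1 by rewrite Egx /gx1 addrA.
have Hgx : isform (a + b).+2%N P gx.
  rewrite Egx1; apply: isform_addS; first exact: isform_hom.
  exact: isform_ordge Hgx1.
have gx0 : gx != 0.
  by apply: isform_neq0 Hgx _ _ => //; rewrite -size_poly_eq0 size_uZ.
apply: idim_mul => //.
  apply: idim_sym.
  have -> : gx = gx2 + (hom (a + b).+1%N ((s * a.+2%:R) *: u ^+ a)
                        + hom (a + b).+2%N ((s * m.+1%:R) *: u ^+ (a + b).+2)) * hom 1%N u.
    rewrite mulrDl !homM ?size_uZ ?size_XsubC //; last by clear; lia.
    by rewrite !addn1 -!scalerAl -!exprSr Egx addrC.
  by apply: idim_addr; apply: idim_sym; apply: idim_u HQ sQ Q0.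
(* [(a+2) Y G - (b+1) g_X] loses its lowest part but then starts with a multiple of [X^m], still
   sharing [X] with [g_X]. Since [m = (a+1) + (b+2)], multiplying by [Y^(b+1)] turns this into a
   multiple of [X^(b+2)] times the lowest part of [g_X]; [lam] is the constant cancelling it. *)
pose lam := - (b.+1%:R * m.+1%:R) / a.+2%:R : K.
pose W := hom b.+1 (b.+1%:R)%:P + hom b.+2 (lam *: u ^+ b.+2).
pose Y := kc a.+2%:R * ypow K b.+2.
have EY : Y = hom b.+2 (a.+2%:R)%:P by rewrite /Y /ypow -homZ alg_polyC.
have sC n (c : K) : (size c%:P <= n.+1)%N by apply: leq_trans (size_polyC_leq1 _) _.
pose z := Y * G2 - hom b.+1 (b.+1%:R)%:P * gx2 - hom b.+2 (lam *: u ^+ b.+2) * gx1.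
have lam0 : lam != 0 by rewrite /lam mulf_neq0 ?invr_eq0 ?oppr_eq0 ?mulf_neq0.
have E1 : Y * hom (a + b).+1%N ((s * b.+1%:R) *: u ^+ a.+1)
        = hom b.+1 (b.+1%:R)%:P * hom (a + b).+2%N P.
  rewrite EY !homM ?sC //; last by rewrite size_uZ ?mulf_neq0 //; clear; lia.
  rewrite (_ : b.+2 + (a + b).+1 = b.+1 + (a + b).+2)%N; last by clear; lia.
  by congr (hom _ _); rewrite /P -!mul_polyC !polyCM; ring.
have E2 : hom b.+1 (b.+1%:R)%:P * hom m ((s * m.+1%:R) *: u ^+ m)
        + hom b.+2 (lam *: u ^+ b.+2) * hom (a + b).+2%N P = 0.
  rewrite !homM ?sC ?size_uZ //; last by clear; lia.
  rewrite (_ : b.+2 + (a + b).+2 = b.+1 + m)%N; last by rewrite /m; clear; lia.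
  rewrite -homD (_ : _ + _ = 0) ?hom0 // /P -!scalerAl -!scalerAr -exprD.
  rewrite (_ : b.+2 + a.+1 = m)%N; last by rewrite /m; clear; lia.
  rewrite mul_polyC !scalerA -scalerDl (_ : _ + _ = 0) ?scale0r //.
  have lamE : lam * a.+2%:R = - (b.+1%:R * m.+1%:R) by rewrite /lam divfK.
  transitivity (s * (b.+1%:R * m.+1%:R + lam * a.+2%:R)); first by ring.
  by rewrite lamE addrN mulr0.
have Ez : z = Y * G + (- W) * gx.
  have E3 : z = Y * G - W * gx - (Y * hom (a + b).+1%N ((s * b.+1%:R) *: u ^+ a.+1)
        - hom b.+1 (b.+1%:R)%:P * hom (a + b).+2%N P)
        + (hom b.+1 (b.+1%:R)%:P * hom m ((s * m.+1%:R) *: u ^+ m)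
        + hom b.+2 (lam *: u ^+ b.+2) * hom (a + b).+2%N P).
    by rewrite /z /W EG Egx1 /gx1; ring.
  by rewrite E3 E1 E2 subrr subr0 addr0 mulNr.
pose Z := (a.+2%:R)%:P * R - (b.+1%:R)%:P * Q
          - (lam *: u ^+ b.+2) * ((s * m.+1%:R) *: u ^+ m).
have HZ : isform (b.+2 + m)%N Z z.
  apply: isformB; last by apply: isformM; rewrite ?size_uZ //; apply: isform_hom.
  apply: isformB; first by rewrite EY; apply: isformM; rewrite ?sC //; apply: isform_hom.
  rewrite (_ : b.+2 + m = b.+1 + m.+1)%N; last by clear; lia.
  by apply: isformM; rewrite ?sC //; apply: isform_hom.
have Z0 : Z.[rho] != 0.
  have uX k : (u ^+ k.+1).[rho] = 0 by rewrite exprS hornerM u_root mul0r.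
  have -> : Z.[rho] = a.+2%:R * R.[rho] - b.+1%:R * Q.[rho]
      - (lam *: u ^+ b.+2).[rho] * ((s * m.+1%:R) *: u ^+ m).[rho].
    by rewrite !(hornerD, hornerN) !hornerM !hornerC.
  by rewrite hornerZ uX mulr0 mul0r subr0.
(* The last term has full degree, thanks to the summand [X^(m+1)] of [E]. As [y] divides the form of
   [g_X], it is [Z] that must supply the exact size in [idim_forms]. *)
have sZ : size Z = (b.+2 + m).+1.
  have sT : size (lam *: u ^+ b.+2 * ((s * m.+1%:R) *: u ^+ m)) = (b.+2 + m).+1.
    by rewrite -scalerAl -scalerAr scalerA -exprD size_uZ // mulf_neq0.
  rewrite /Z addrC size_polyDl size_polyN sT //.
  apply: leq_ltn_trans (size_polyD _ _) _; rewrite size_polyN gtn_max !mul_polyC.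
  apply/andP; split; apply: leq_ltn_trans (size_scale_leq _ _) _.
    by apply: leq_ltn_trans sR _; clear; lia.
  by apply: leq_ltn_trans sQ _; clear; lia.
have D1 : idim gx (Y * G) ((m + b.+2) * (a + b).+2).
  apply: (@idim_addl _ _ _ (- W)); rewrite -Ez; apply: idim_sym; rewrite [(m + _)%N]addnC.
  apply: idim_forms HZ Hgx _ sZ sP.
  by rewrite coprimepZr // coprimep_sym coprimep_u.
(* Modulo [y], [g_X] starts with a multiple of [X^m], so the auxiliary factor [y^(b+2)] accounts for
   [(b+2) m]. *)
apply: idim_cancel D1 _ => //.
apply: idim_unitr; first by rewrite /ev0 kcE.
rewrite ypow_exp; apply: idim_exp => //; apply: idim_sym.
have -> : gx = gx1 + hom (a + b).+1%N P * ypow K 1%N.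
  rewrite /ypow homM ?size_poly1 ?mulr1 ?addn1 1?addrC //.
  by rewrite size_uZ //; clear; lia.
by apply: idim_addr; apply: idim_ypow1 Hgx1 _; rewrite size_uZ.
Qed.
End Families.

(** * Derivatives in the coordinates [X] and [Y] *)

Section Jacobian.
Variable K : numClosedFieldType.
Implicit Types (P Q R A : {poly K}) (f g e gx gy : germ K).
Variable rho : K.
Let u : {poly K} := 'X - rho%:P.

(* [gx] and [gy] are the derivatives of [g] in the coordinates [x - rho y] and [y]. *)
Definition jac g gx gy :=
  (forall i j, gx i j = g i.+1 j *+ i.+1) /\
  (forall i j, gy i j - rho * gx i j = g i j.+1 *+ j.+1).

Lemma jacD f fx fy g gx gy : jac f fx fy -> jac g gx gy -> jac (f + g) (fx + gx) (fy + gy).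
Proof.
move=> [Hfx Hfy] [Hgx Hgy]; split=> i j; rewrite !germDE mulrnDl; first by rewrite Hfx Hgx.
by rewrite -Hfy -Hgy; ring.
Qed.

Lemma jacZ c g gx gy : jac g gx gy -> jac (kc c * g) (kc c * gx) (kc c * gy).
Proof.
move=> [Hgx Hgy]; split=> i j; rewrite !kcME -mulrnAr; first by rewrite Hgx.
by rewrite -Hgy; ring.
Qed.

Lemma jac0 : jac 0 0 0.
Proof. by split=> i j; rewrite !germ0E mul0rn // mulr0 subr0. Qed.

(** The second derivative comes from Euler's relation [X g_X + Y g_Y = (n+1) g] at [Y = 1]. *)
Lemma jac_hom n P :
  jac (hom n.+1 P) (hom n P^`()) (hom n (n.+1%:R *: P - u * P^`())).
Proof.
split=> i j; rewrite !homE; first by rewrite coef_deriv addSn eqSS; case: eqP; rewrite ?mul0rn.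
rewrite addnS eqSS; case: eqP => [E|_]; last by rewrite !mulr0n mulr0 mul0rn subr0.
rewrite !mulr1n coefB coefZ /u mulrBl coefB coefXM mul_polyC coefZ -addrA -opprD subrK.
rewrite -E -[RHS]mulr_natl; case: i E => [|i] E /=; first by rewrite subr0.
rewrite coef_deriv -[P`_i.+1 *+ _]mulr_natl -mulrBl; congr (_ * _).
by rewrite -addnS natrD [X in X - _]addrC addrK.
Qed.

Lemma deriv_u k : (u ^+ k.+1)^`() = k.+1%:R *: u ^+ k.
Proof. by rewrite deriv_exp derivXsubC mul1r scaler_nat. Qed.

Lemma jac_u n k c :
  jac (hom n.+1 (c *: u ^+ k.+1)) (hom n ((c * k.+1%:R) *: u ^+ k))
      (hom n ((c * (n.+1%:R - k.+1%:R)) *: u ^+ k.+1)).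
Proof.
have := jac_hom n (c *: u ^+ k.+1); rewrite derivZ deriv_u scalerA.
rewrite -scalerAr -exprS scalerA -scalerBl.
by rewrite (_ : n.+1%:R * c - c * k.+1%:R = c * (n.+1%:R - k.+1%:R)) //; ring.
Qed.
End Jacobian.

(** * Colengths on the deformations of a form *)

Section Values.
Variable K : numClosedFieldType.
Implicit Types (P Q R A : {poly K}) (f g e gx gy : germ K).

(* The Jacobian ideal does not depend on the coordinate [x - rho y]. *)
Definition mu g n := exists rho gx gy, jac rho g gx gy /\ idim gx gy n.

Lemma root_deriv_mul rho Q : (('X - rho%:P) * Q)^`().[rho] = Q.[rho].
Proof.
by rewrite derivM derivXsubC mul1r hornerD hornerM hornerXsubC subrr mul0r addr0.
Qed.

Lemma size_deriv_leq n P : (size P <= n.+1)%N -> (size P^`() <= n)%N.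
Proof. by move=> sP; apply: leq_trans (size_poly _ _) _; rewrite -subn1 leq_subLR. Qed.

Lemma size_euler n rho P : (size P <= n.+2)%N ->
  (size (n.+1%:R *: P - ('X - rho%:P) * P^`())%R <= n.+1)%N.
Proof.
move=> sP; apply/leq_sizeP => j nj.
have P0 i : (n.+2 <= i)%N -> P`_i = 0 by move=> ni; rewrite nth_default // (leq_trans sP).
rewrite coefB coefZ mulrBl coefB coefXM mul_polyC coefZ !coef_deriv.
rewrite (P0 j.+1) // mul0rn mulr0 subr0.
case: j nj => // j nj /=; case: (ltngtP j n) nj => [//|nj _|-> _]; first by lia.
  by rewrite P0 // mulr0 mul0rn subr0.
by rewrite mulr_natl subrr.
Qed.

Variables (d : nat) (Q : {poly K}).
Hypothesis sQ : (size Q <= d.+1)%N.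
Let f := hom d Q.

(** For [h + 2 = d] the next form is [f0], and the hypotheses on [rho] and [kappa] give [R.[rho] !=
    0] and coprimality. Otherwise it is [s (Y^(h+2) + X Y^(h+1))]: the second term makes the
    [X]-derivative coprime to everything, the first gives [R.[rho] = s (h+2)]. For [b = 0],
    [kappa != 1] keeps [A] nonzero. *)
Lemma mu_A c b rho kappa s : let h := (c + b)%N in
    (h.+2 <= d)%N -> Q.[rho] != 0 -> kappa != 0 -> kappa != 1 ->
    coprimep (c.+1%:R%:P - (kappa * h.+1%:R) *: ('X - rho%:P) ^+ b) Q^`() -> s != 0 ->
  mu (f + kc s * (hom h.+1 (('X - rho%:P) ^+ c.+1 - kappa *: ('X - rho%:P) ^+ h.+1)
        + (if h.+2 == d then 0 else hom h.+2 (1 + ('X - rho%:P)))))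
     (h * (b + h.+1) - b * h.+1).
Proof.
set u := 'X - rho%:P => h hd Qr k0 k1 cop s0.
set A := _%:P - _ in cop; set e := (if _ then _ else _).
have sA : size A = b.+1.
  rewrite /A /h; case: (b) => [|b'].
    rewrite addn0 expr0 alg_polyC -polyCB size_polyC -[X in X - _]mul1r -mulrBl.
    by rewrite mulf_neq0 ?pnatr_eq0 // subr_eq0 eq_sym.
  rewrite addrC size_polyDl size_polyN size_uZ ?mulf_neq0 ?pnatr_eq0 //.
  exact: leq_ltn_trans (size_polyC_leq1 _) _.
have A0 : A.[rho] != 0.
  rewrite /A /h hornerD hornerN hornerZ hornerC; case: (b) => [|b'].
    rewrite addn0 expr0 hornerC mulr1 -[X in X - _]mul1r -mulrBl.
    by rewrite mulf_neq0 ?pnatr_eq0 // subr_eq0 eq_sym.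
  by rewrite exprS hornerM /u hornerXsubC subrr mul0r mulr0 subr0 pnatr_eq0.
have JP : jac rho (hom h.+1 (u ^+ c.+1 - kappa *: u ^+ h.+1)) (hom h (u ^+ c * A))
             (hom h (b%:R *: u ^+ c.+1)).
  have := jacD (jac_u rho h c 1) (jac_u rho h h (- kappa)).
  rewrite -/u -!homD scale1r scaleNr subrr mulr0 scale0r addr0 !mul1r.
  rewrite (_ : h.+1%:R - c.+1%:R = b%:R); last by rewrite -addSn natrD addrC addKr.
  congr (jac _ _ (hom _ _) _); rewrite /A mulrBr [_ * _%:P]mulrC mul_polyC.
  by rewrite -scalerAr -exprD mulNr scaleNr.
have [ex [ey [Je [R [Q' [fx [fy [Jf H]]]]]]]] : exists ex ey, jac rho e ex ey /\
   exists R Q' fx fy, jac rho f fx fy /\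
  [/\ coprimep A Q', R.[rho] != 0, (size Q' <= h.+2)%N /\ (size R <= h.+2)%N,
      isform h.+1 Q' (fx + kc s * ex) & isform h.+1 R (fy + kc s * ey)].
  rewrite /e; case: eqP => hd'.
    exists 0, 0; split; first exact: jac0.
    exists (h.+2%:R *: Q - u * Q^`()), Q^`(), (hom h.+1 Q^`()), (hom h.+1 (h.+2%:R *: Q - u * Q^`())).
    split; first by rewrite /f -hd'; apply: jac_hom.
    rewrite !mulr0 !addr0; split=> //; rewrite ?isform_hom //.
    - rewrite hornerD hornerN hornerZ hornerM /u hornerXsubC subrr mul0r subr0.
      by rewrite mulf_neq0 ?pnatr_eq0.
    - by split; [apply: size_deriv_leq | apply: size_euler]; rewrite hd'.
    - exact: isform_hom.
    - exact: isform_hom.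
  exists (hom h.+1 1), (hom h.+1 (h.+2%:R *: (1 + u) - u)); split.
    have := jac_hom rho h.+1 (1 + u).
    by rewrite derivD -polyC1 derivC derivXsubC add0r -/u mulr1.
  exists (s *: (h.+2%:R *: (1 + u) - u)), (s *: 1).
  have dE : d = d.-1.+1 by lia.
  exists (hom d.-1 Q^`()), (hom d.-1 (d.-1.+1%:R *: Q - u * Q^`())).
  split; first by rewrite /f {1}dE; apply: jac_hom.
  have od P : ordge h.+2 (hom d.-1 P) by apply: ordgeW (@hom_ordge K _ _); lia.
  rewrite -!homZ; split.
  - by rewrite coprimepZr // coprimep1.
  - rewrite hornerZ mulf_neq0 // hornerD hornerN hornerZ hornerD hornerC /u hornerXsubC.
    by rewrite subrr addr0 subr0 mulr1 pnatr_eq0.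
  - split; apply: leq_trans (size_scale_leq _ _) _; first by rewrite size_poly1.
    apply: leq_trans (size_polyD _ _) _; rewrite geq_max size_polyN size_XsubC andbT.
    apply: leq_trans (size_scale_leq _ _) _; apply: leq_trans (size_polyD _ _) _.
    by rewrite geq_max size_poly1 size_XsubC.
  - by rewrite [X in isform _ _ X]addrC; apply: isform_addS => //; apply: isform_hom.
  - by rewrite [X in isform _ _ X]addrC; apply: isform_addS => //; apply: isform_hom.
case: H => AQ' R0 [sQ' sR] Hx Hy.
exists rho, (fx + kc s * (hom h (u ^+ c * A) + ex)), (fy + kc s * (hom h (b%:R *: u ^+ c.+1) + ey)).
split; first by apply: jacD => //; apply: jacZ; apply: jacD.
apply: (milnor_family_A s0 sA A0 AQ' R0 sQ' sR Hx Hy).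
  by rewrite mulrDr homZ; ring.
by rewrite mulrDr -scalerA [X in _ = X + _]homZ; ring.
Qed.

(** If the lowest form is [X F], its [Y]-derivative is [X F_Y], and the added form [X Y^(n+1)]
    preserves this shape. On [X = 0] the [X]-derivative is [F], and Euler's relation for [F], of
    degree [n + 1], gives [R.[rho] = (n+1) P.[rho]]. *)
Lemma deflated_remainder rho Q1 n s : Q = ('X - rho%:P) * Q1 -> Q1.[rho] != 0 ->
    (n.+2 <= d)%N -> s != 0 ->
  exists gx G P R, [/\ jac rho (f + kc s * (if n.+2 == d then 0 else hom n.+2 ('X - rho%:P)))
                           gx (hom 1%N ('X - rho%:P) * G),
    isform n.+1 P gx, isform n R G, (size P <= n.+2)%N /\ (size R <= n.+1)%N &
    P.[rho] != 0 /\ R.[rho] = n.+1%:R * P.[rho]].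
Proof.
set u := 'X - rho%:P => QE Q10 nd s0.
have Q1_neq0 : Q1 != 0 by apply: contraNneq Q10 => ->; rewrite horner0.
have dE : d = d.-2.+2 by lia.
have sQ1 : (size Q1 <= d.-1.+1)%N.
  have := sQ; rewrite QE size_mul ?polyXsubC_eq0 // size_XsubC /=.
  by move: (size (polyseq Q1)) => x; lia.
have Jf : jac rho f (hom d.-2.+1 Q^`()) (hom 1%N u * hom d.-2 (d.-2.+1%:R *: Q1 - u * Q1^`())).
  rewrite homM ?size_XsubC //; last by apply: size_euler; rewrite (_ : d.-2.+2 = d.-1.+1) //; lia.
  rewrite /f {1}dE; have := jac_hom rho d.-2.+1 Q; congr (jac _ _ _ (hom _ _)).
  rewrite -/u QE derivM derivXsubC mul1r -[d.-2.+2%:R]natr1 scalerDl scale1r.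
  by rewrite -!mul_polyC; ring.
case: eqP => nd'.
  exists (hom n.+1 Q^`()), (hom n (n.+1%:R *: Q1 - u * Q1^`())), Q^`(),
    (n.+1%:R *: Q1 - u * Q1^`()).
  have En : n = d.-2 by rewrite -nd'.
  split.
  - by rewrite mulr0 addr0 En.
  - exact: isform_hom.
  - exact: isform_hom.
  - split; first by apply: size_deriv_leq; rewrite nd'.
    by apply: size_euler; rewrite -nd' in sQ1.
  - rewrite QE root_deriv_mul hornerD hornerN hornerZ hornerM /u hornerXsubC subrr.
    by rewrite mul0r subr0.
exists (hom d.-2.+1 Q^`() + kc s * hom n.+1 1),
  (hom d.-2 (d.-2.+1%:R *: Q1 - u * Q1^`()) + kc s * hom n (n.+1%:R%:P)),
  (s *: 1), (s *: n.+1%:R%:P).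
have od P k : (k <= d.-2)%N -> ordge k (hom d.-2 P) by move=> kd; apply: ordgeW (@hom_ordge K _ _).
have od1 P k : (k <= d.-2.+1)%N -> ordge k (hom d.-2.+1 P) by move=> kd; apply: ordgeW (@hom_ordge K _ _).
split.
- rewrite mulrDr; apply: jacD => //; rewrite mulrCA; apply: jacZ.
  have -> : hom 1%N u * hom n (n.+1%:R%:P) = hom n.+1 ((1 * (n.+2%:R - 1%:R)) *: u ^+ 1).
    rewrite homM ?size_XsubC //; last exact: leq_trans (size_polyC_leq1 _) _.
    by rewrite mul1r mulrC mul_polyC expr1 -[n.+2%:R]natr1 addrK.
  by have := jac_u rho n.+1 0 1; rewrite !scale1r mul1r scale1r expr0.
- by rewrite -homZ [X in isform _ _ X]addrC; apply: isform_addS; [apply: isform_hom | apply: od1; lia].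
- by rewrite -homZ [X in isform _ _ X]addrC; apply: isform_addS; [apply: isform_hom | apply: od; lia].
- by split; apply: leq_trans (size_scale_leq _ _) _; apply: leq_trans (size_polyC_leq1 _) _.
- by rewrite !hornerZ !hornerC mulr1 mulrC.
Qed.

Lemma mu_C rho Q1 h s : Q = ('X - rho%:P) * Q1 -> Q1.[rho] != 0 ->
    (h.+3 <= d)%N -> s != 0 ->
  mu (f + kc s * (hom h.+2 (('X - rho%:P) ^+ h.+2)
        + (if h.+3 == d then 0 else hom h.+3 ('X - rho%:P))))
     (h.+2 + h.+1 * h.+1).
Proof.
set u := 'X - rho%:P => QE Q10 hd s0.
have [gx [G [P [R [J HP HR [sP sR] [P0 R0]]]]]] := deflated_remainder QE Q10 hd s0.
exists rho, (gx + kc s * hom h.+1 (h.+2%:R *: u ^+ h.+1)), (hom 1%N u * G); split.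
  have := jacD J (jacZ s (jac_u rho h.+1 h.+1 1)).
  by rewrite -/u subrr mulr0 scale0r hom0 mulr0 addr0 scale1r mul1r mulrDr addrAC addrA.
apply: (@milnor_family_C _ rho h P R (s * h.+2%:R) _ _ gx G) => //.
- by rewrite mulf_neq0 ?pnatr_eq0.
- by rewrite R0 mulf_neq0 ?pnatr_eq0.
by rewrite -homZ scalerA addrC.
Qed.

Lemma mu_B rho Q1 a b s : let m := (a + b).+3 in
    Q = ('X - rho%:P) * Q1 -> Q1.[rho] != 0 -> (m.+2 <= d)%N -> s != 0 ->
  mu (f + kc s * (hom m (('X - rho%:P) ^+ a.+2) + hom m.+1 (('X - rho%:P) ^+ m.+1)
        + (if m.+2 == d then 0 else hom m.+2 ('X - rho%:P))))
     (m.+1 + ((m + b.+2) * (a + b).+2 - b.+2 * m)).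
Proof.
set u := 'X - rho%:P => m QE Q10 hd s0.
have [gx [G [P [R [J HP HR [sP sR] [P0 R0]]]]]] := deflated_remainder QE Q10 hd s0.
pose g1 := hom (a + b).+1 ((s * b.+1%:R) *: u ^+ a.+1).
exists rho, (hom (a + b).+2 ((s * a.+2%:R) *: u ^+ a.+1)
         + hom m ((s * m.+1%:R) *: u ^+ m) + gx), (hom 1%N u * (g1 + G)); split.
  have := jacD (jacD (jac_u rho (a + b).+2 a.+1 s) (jac_u rho m m s)) J.
  rewrite -/u subrr mulr0 scale0r hom0 addr0.
  have -> : (a + b).+3%:R - a.+2%:R = b.+1%:R :> K.
    by rewrite (_ : (a + b).+3 = a.+2 + b.+1)%N ?natrD 1?addrC ?addKr //; lia.
  have -> : hom 1%N u * (g1 + G)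
      = hom (a + b).+2 ((s * b.+1%:R) *: u ^+ a.+2) + hom 1%N u * G.
    rewrite mulrDr; congr (_ + _); rewrite homM ?size_XsubC //; last first.
      by apply: leq_trans (size_scale_leq _ _) _; rewrite u_size; clear; lia.
    by rewrite add1n -scalerAr -exprS.
  rewrite -/m !(homZ _ s); set e := (if _ then _ else _).
  by have -> // : f + kc s * (hom m (u ^+ a.+2) + hom m.+1 (u ^+ m.+1) + e)
    = kc s * hom m (u ^+ a.+2) + kc s * hom m.+1 (u ^+ m.+1) + (f + kc s * e) by ring.
apply: (@milnor_family_B _ rho a b P R s _ _ gx (g1 + G) G) => //.
(* The condition becomes [(a+2)(m+1) != b+1], which holds because [m > b]. *)
rewrite R0 mulrA -mulrBl mulf_neq0 // -natrM subr_eq0 eqr_nat -/m.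
by apply/eqP; rewrite /m; lia.
Qed.
End Values.

(** * Binary forms as homogenized polynomials *)

Section HomogeneousPolynomials.
Variable K : numClosedFieldType.
Implicit Types (P Q : {poly K}).

Definition mon i j : 'X_{1..2} := [multinom [tuple i; j]].
Definition homogenize n P : {mpoly K[2]} := \sum_(i < n.+1) P`_i *: 'X_[mon i (n - i)%N].

Lemma monE i j (t : 'I_2) : mon i j t = if t == 0%N :> nat then i else j.
Proof. by rewrite /mon /fun_of_multinom /= (tnth_nth 0%N); case: t => [[|[|t]]]. Qed.

Lemma monD i j k l : (mon i j + mon k l)%MM = mon (i + k)%N (j + l)%N.
Proof. by apply/mnmP => t; rewrite mnmDE !monE; case: eqP. Qed.

Lemma mdeg_mon i j : mdeg (mon i j) = (i + j)%N.
Proof. by rewrite mdegE !big_ord_recl big_ord0 addn0 !monE. Qed.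

Lemma mon_eta (t : 'X_{1..2}) : exists i j, t = mon i j.
Proof.
exists (t ord0), (t (lift ord0 ord0)); apply/mnmP => k; rewrite monE.
by case: k => [[|[|k]]] lt //; congr (t _); apply: val_inj.
Qed.

Lemma mon_inj i j k l : (mon i j == mon k l) = (i == k) && (j == l).
Proof.
apply/eqP/andP => [E|[/eqP -> /eqP ->]] //.
have := congr1 (fun t : 'X_{1..2} => (t ord0, t (lift ord0 ord0))) E.
by rewrite !monE => -[-> ->].
Qed.

Lemma mcoeff_homogenize n P i j : (homogenize n P)@_(mon i j) = P`_i *+ (i + j == n)%N *+ (i <= n)%N.
Proof.
rewrite /homogenize raddf_sum /=.
under eq_bigr => t _ do rewrite mcoeffZ mcoeffX mon_inj.
case: (leqP i n) => [lin|nin]; last first.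
  rewrite mulr0n big1 // => t _; have := ltn_ord t.
  by case: eqP => [->|_ _]; [lia | rewrite mulr0].
rewrite -ltnS in lin; rewrite (bigD1 (Ordinal lin)) //= big1 ?addr0 => [|t ti]; last first.
  by rewrite -val_eqE /= in ti; rewrite (negbTE ti) /= mulr0.
rewrite eqxx /= mulr1n mulr_natr; congr (_ *+ nat_of_bool _); clear -lin; apply/eqP/eqP; lia.
Qed.

Lemma homogenize_mulX n P rho : (size P <= n.+1)%N ->
  homogenize n.+1 (('X - rho%:P) * P) = ('X_[mon 1%N 0%N] - rho *: 'X_[mon 0%N 1%N]) * homogenize n P.
Proof.
move=> sP; rewrite [RHS]mulrBl; set r := 'X_[mon 0%N 1%N].
have E1 : 'X_[mon 1%N 0%N] * homogenize n P = \sum_(i < n.+2) ('X * P)`_i *: 'X_[mon i (n.+1 - i)%N].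
  rewrite big_ord_recl coefXM eqxx scale0r add0r big_distrr; apply: eq_bigr => i _.
  by rewrite coefXM /= -scalerAr -mpolyXD monD.
have E2 : r * homogenize n P = \sum_(i < n.+2) P`_i *: 'X_[mon i (n.+1 - i)%N].
  rewrite big_ord_recr /= nth_default // scale0r addr0 big_distrr; apply: eq_bigr => i _.
  by rewrite /= -scalerAr -mpolyXD monD add0n add1n subSn // -ltnS.
rewrite -scalerAl E1 E2 scaler_sumr -sumrB; apply: eq_bigr => i _.
by rewrite mulrBl coefB mul_polyC coefZ scalerBl scalerA.
Qed.

Lemma homogenize_mulY n P : (size P <= n.+1)%N ->
  homogenize n.+1 P = 'X_[mon 0%N 1%N] * homogenize n P.
Proof.
move=> sP; rewrite /homogenize big_ord_recr /= nth_default // scale0r addr0 big_distrr.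
by apply: eq_bigr => i _; rewrite /= -scalerAr -mpolyXD monD add0n add1n subSn // -ltnS.
Qed.

Lemma msize_linear_form i j (h : {mpoly K[2]}) : (i + j = 1)%N -> h@_(mon i j) != 0 ->
  ~~ (msize h <= 1)%N.
Proof.
move=> ij; rewrite -mcoeff_msupp => /msize_mdeg_lt; rewrite mdeg_mon ij -ltnNge.
by [].
Qed.
End HomogeneousPolynomials.

(** * Dehomogenization of a form without multiple factors *)

Section SquarefreeForm.
Variables (K : numClosedFieldType) (d : nat) (f0 : {mpoly K[2]}).
Hypotheses (d3 : (3 <= d)%N) (f0_hom : f0 \is d.-homog).
Hypothesis f0_sqfree :
  forall h q : {mpoly K[2]}, f0 = h * h * q -> (msize h <= 1)%N.

Definition dehom : {poly K} := \poly_(i < d.+1) f0@_(mon i (d - i)%N).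

Lemma size_dehom : (size dehom <= d.+1)%N. Proof. exact: size_poly. Qed.

Lemma mcoeff_dehom i j : f0@_(mon i j) = hom d dehom i j.
Proof.
rewrite homE coef_poly; case: eqP => [E|ne]; last first.
  rewrite mulr0n; apply/eqP; rewrite mcoeff_eq0; apply/negP => Hm.
  by have /dhomogP/(_ _ Hm) := f0_hom; rewrite /= mdeg_mon.
by rewrite mulr1n ifT; [congr (_@_(mon _ _)); lia | lia].
Qed.

Lemma f0_homogenize : f0 = homogenize d dehom.
Proof.
apply/mpolyP => t; have [i [j ->]] := mon_eta t.
rewrite mcoeff_homogenize mcoeff_dehom homE; case: (leqP i d) => [_|di] //.
by rewrite (_ : (i + j == d)%N = false) ?mulr0n //; apply/eqP; lia.
Qed.

(** A drop of the degree by two or more would make [y^2] divide [f0]. *)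
Lemma dehom_size_ge : (d <= size dehom)%N.
Proof.
rewrite leqNgt; apply/negP => lt.
have dE : d = d.-2.+2 by lia.
have : (msize ('X_[mon 0%N 1%N] : {mpoly K[2]}) <= 1)%N.
  apply: (@f0_sqfree _ (homogenize d.-2 dehom)).
  rewrite {1}f0_homogenize dE -mulrA -!homogenize_mulY //.
    by move: lt; move: (size (polyseq _)) => x; lia.
  by move: lt; move: (size (polyseq _)) => x; lia.
apply/negP; apply: (@msize_linear_form K 0%N 1%N) => //.
by rewrite mcoeffX eqxx oner_neq0.
Qed.

Lemma dehom_neq0 : dehom != 0.
Proof. by rewrite -size_poly_gt0; apply: leq_trans dehom_size_ge; lia. Qed.

(** A double root [rho] would make [(x - rho y)^2] divide [f0]. *)
Lemma dehom_sqfree rho Q1 : dehom = ('X - rho%:P) * Q1 -> Q1.[rho] != 0.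
Proof.
move=> E; apply/negP => /factor_theorem[Q2 E2].
have Q20 : Q2 != 0 by apply: contraNneq dehom_neq0 => Q20; rewrite E E2 Q20 mul0r mulr0.
have sQ2 : (size Q2 <= d.-2.+1)%N.
  have := size_dehom; rewrite E E2 mulrC -mulrA !size_mul ?polyXsubC_eq0 ?mulf_neq0 ?polyXsubC_eq0 //.
  by rewrite !size_XsubC; move: (size (polyseq Q2)) => x; lia.
pose h : {mpoly K[2]} := 'X_[mon 1%N 0%N] - rho *: 'X_[mon 0%N 1%N].
have : (msize h <= 1)%N.
  apply: (@f0_sqfree _ (homogenize d.-2 Q2)).
  have dE : d = d.-2.+2 by lia.
  rewrite {1}f0_homogenize E E2 [Q2 * _]mulrC {1}dE -mulrA -!homogenize_mulX //.
  by rewrite size_mul ?polyXsubC_eq0 // size_XsubC.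
apply/negP; apply: (@msize_linear_form K 1%N 0%N) => //.
by rewrite mcoeffB mcoeffZ !mcoeffX !mon_inj /= mulr0 subr0 oner_neq0.
Qed.

Lemma dehom_deriv_neq0 : dehom^`() != 0.
Proof.
have sd : (3 <= size dehom)%N := leq_trans d3 dehom_size_ge.
apply/eqP => /(congr1 (fun P : {poly K} => P`_(size dehom).-2)).
rewrite coef_deriv coef0 (_ : (size dehom).-2.+1 = (size dehom).-1); last first.
  by move: sd; move: (size (polyseq _)) => x; lia.
move/eqP; rewrite -lead_coefE mulrn_eq0 lead_coef_eq0 -size_poly_eq0.
by move: sd; move: (size (polyseq _)) => x; lia.
Qed.

Lemma dehom_root : exists rho Q1, dehom = ('X - rho%:P) * Q1 /\ Q1.[rho] != 0.
Proof.
have [rho /factor_theorem[Q1 E]] : exists rho, root dehom rho.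
  apply/closed_rootP; have := dehom_size_ge; apply: contraTneq => ->; lia.
by exists rho, Q1; rewrite mulrC; split=> //; apply: dehom_sqfree; rewrite mulrC.
Qed.
End SquarefreeForm.

(** * Generic choice of constants *)

(** Starting at 2 builds in that the value is neither 0 nor 1, as required of [kappa]. *)
Lemma nat_avoids (K : numClosedFieldType) (l : seq K) : exists n : nat, n.+2%:R \notin l.
Proof.
apply: contrapT => H.
have sub : {subset [seq n.+2%:R : K | n <- iota 0 (size l).+1] <= l}.
  by move=> x /mapP[n _ ->]; apply: contrapT => nl; apply: H; exists n; apply/negP.
have U : uniq [seq n.+2%:R : K | n <- iota 0 (size l).+1].
  by rewrite map_inj_uniq ?iota_uniq // => i j /eqP; rewrite eqr_nat => /eqP[].
by have := uniq_leq_size U sub; rewrite size_map size_iota ltnn.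
Qed.

Section Avoidance.
Variable K : numClosedFieldType.
Implicit Types P : {poly K}.

Lemma poly_roots_seq P : P != 0 -> exists l : seq K, forall x, root P x -> x \in l.
Proof.
move=> P0; have [l E] := closed_field_poly_normal P; exists l => x.
by rewrite E rootZ ?lead_coef_eq0 // root_prod_XsubC.
Qed.

Lemma nonroot_exists P : P != 0 -> exists x, P.[x] != 0.
Proof.
case/poly_roots_seq => l Hl; have [n nl] := nat_avoids l.
by exists n.+2%:R; apply: contra nl => /Hl.
Qed.

(** A common root [x] forces [kappa = c / (m (x - rho)^b)], and [P] has finitely many roots. *)
Lemma kappa_exists P (rho c m : K) b : P != 0 -> c != 0 -> exists kappa : K,
  [/\ kappa != 0, kappa != 1 & coprimep (c%:P - (kappa * m) *: ('X - rho%:P) ^+ b) P].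
Proof.
move=> P0 c0; have [l Hl] := poly_roots_seq P0.
have [n nl] := nat_avoids [seq c / (m * (x - rho) ^+ b) | x <- l].
exists n.+2%:R; split; rewrite ?pnatr_eq0 ?pnatr_eq1 //.
apply/Pdiv.ClosedField.coprimepP => x; rewrite /root => /eqP Ax.
apply/negP => /Hl xl; case/negP: nl; apply/mapP; exists x => //.
move: Ax; rewrite hornerD hornerN hornerZ hornerC horner_exp hornerXsubC -mulrA => /eqP.
rewrite subr_eq0 => /eqP cE; rewrite {1}cE mulfK //.
by apply: contraNneq c0 => z; rewrite cE z mulr0.
Qed.
End Avoidance.

(** * Convergence of linear deformations *)

Section Convergence.
Variable K : numClosedFieldType.

Lemma geom_boundedP (a : nat -> nat -> K) :
  (exists r M : K, 0 < r /\ forall i j, `|a i j| * r ^+ (i + j) <= M)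
  <-> geom_bounded (PS (fun i => PS (a i))).
Proof.
split=> [[r [M [r0 H]]]|[M [L [M0 L0 H]]]].
  exists M, r^-1; split; rewrite ?invr_gt0 //.
    by apply: le_trans (H 0%N 0%N); rewrite expr0 mulr1 normr_ge0.
  move=> i j; rewrite exprVn; apply: le_trans (_ : (`|a i j| * r ^+ (i + j)) / r ^+ (i + j) <= _).
    by rewrite mulfK // expf_neq0 // gt_eqF.
  by apply: ler_wpM2r => //; rewrite invr_ge0 exprn_ge0 // ltW.
exists L^-1, M; split; rewrite ?invr_gt0 // => i j.
rewrite exprVn ler_pdivrMr ?exprn_gt0 //; exact: H.
Qed.

Definition linear_deformation (f e : germ K) i j k : K :=
  match k with 0%N => f i j | 1%N => e i j | _ => 0 end.

Lemma linear_deformation_convergent (f e : germ K) : exists r M : K, 0 < r /\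
  forall i j k, `|linear_deformation f e i j k| * r ^+ (i + j + k) <= M.
Proof.
have [M1 [L1 [M10 L10 H1]]] := germP f; have [M2 [L2 [M20 L20 H2]]] := germP e.
(* [L] dominates both ratios, and the summand 1 makes [L^k >= 1], which absorbs the exponent of
   [s]. *)
pose L := 1 + L1 + L2.
have L0 : 0 < L by rewrite /L !addr_gt0.
have L1L : L1 <= L by rewrite /L -addrA addrCA lerDl addr_ge0 // ltW.
have L2L : L2 <= L by rewrite /L lerDr addr_ge0 // ltW.
have LL : 1 <= L by rewrite /L -addrA lerDl addr_ge0 // ltW.
exists L^-1, (M1 + M2); split=> [|i j k]; first by rewrite invr_gt0.
rewrite exprVn ler_pdivrMr ?exprn_gt0 //.
have B (M M' L' x : K) : 0 <= M -> 0 < L' -> L' <= L -> M <= M' -> x <= M * L' ^+ (i + j) ->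
    x <= M' * L ^+ (i + j + k).
  move=> M0 L'0 L'L MM' Hx; apply: le_trans Hx _; apply: ler_pM => //.
    by rewrite exprn_ge0 // ltW.
  apply: (@le_trans _ _ (L ^+ (i + j))).
    by apply: lerXn2r; rewrite ?nnegrE ?(ltW L'0) ?(ltW L0).
  by rewrite [X in _ <= X]exprD ler_peMr ?exprn_ge0 ?exprn_ege1 // ltW.
case: k B => [|[|k]] B.
- by apply: (B M1 _ L1) => //; [rewrite lerDl | apply: H1].
- by apply: (B M2 _ L2) => //; [rewrite lerDr | apply: H2].
- by rewrite normr0 mulr_ge0 ?addr_ge0 ?exprn_ge0 // ltW.
Qed.

Lemma linear_deformation_sum (f e : germ K) s i j m :
  \sum_(k < m.+2) linear_deformation f e i j k * s ^+ k = (f + kc s * e) i j.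
Proof.
rewrite 2!big_ord_recl big1 => [|k _]; last by rewrite mul0r.
by rewrite germDE kcME /= expr0 expr1 mulr1 addr0 [e i j * s]mulrC.
Qed.
End Convergence.

(** * Transfer to the definitions of the statement *)

Lemma mul2E (a b : germ C) (b' : ser2) : (forall i j, b i j = b' i j) ->
  forall i j, mul2 (fun i j => a i j) b' i j = (a * b) i j.
Proof.
move=> E i j; rewrite germME; apply: eq_bigr => k _; apply: eq_bigr => l _.
by rewrite E.
Qed.

Lemma convergent2_germ (a : ser2) : convergent2 a -> exists p : germ C, forall i j, p i j = a i j.
Proof. by move=> /geom_boundedP Ha; exists (mkgerm Ha). Qed.

Lemma germ_convergent2 (p : germ C) : convergent2 (fun i j => p i j).
Proof.
apply/geom_boundedP; have [M [L [M0 L0 H]]] := germP p.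
by exists M, L.
Qed.

Lemma lincombE n (c : 'I_n -> C) (e : 'I_n -> germ C) i j :
  lincomb (@kc C) c e i j = \sum_(t < n) c t * e t i j.
Proof. by rewrite /lincomb germ_sumE; apply: eq_bigr => t _; rewrite kcME. Qed.

Lemma mu_milnor (g : germ C) (g' : ser2) n :
  (forall i j, g i j = g' i j) -> mu g n -> milnor g' n.
Proof.
move=> Eg [rho [gx [gy [[Jx Jy] [[e [Se De]] _]]]]].
(* This is the derivative by [y], so [(g_X, g_Y)] and the Jacobian ideal in [x, y] coincide. *)
pose gz := gy - kc rho * gx.
have Ex i j : gx i j = dx2 g' i j by rewrite Jx Eg.
have Ez i j : gz i j = dy2 g' i j by rewrite germBE kcME Jy Eg.
exists (fun t i j => e t i j); split; first by move=> t; apply: germ_convergent2.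
split=> [h /convergent2_germ[p Ep]|c a b /convergent2_germ[p Ep] /convergent2_germ[q Eq] E].
  have [c [a [b E]]] := Se p.
  pose a' := a + kc rho * b.
  exists c, (fun i j => a' i j), (fun i j => b i j).
  split; first exact: germ_convergent2.
  split; first exact: germ_convergent2.
  move=> i j; rewrite (mul2E a' Ex) (mul2E b Ez) -lincombE -!germDE -Ep; congr (germ_val _ i j).
  have -> : p = lincomb (@kc C) c e + (p - lincomb (@kc C) c e) by rewrite addrC subrK.
  by rewrite E /a' /gz; ring.
apply: De; exists (p - kc rho * q), q.
have -> : (p - kc rho * q) * gx + q * gy = p * gx + q * gz by rewrite /gz; ring.
apply: germ_ext => i j; rewrite lincombE E germDE -(mul2E p Ex) -(mul2E q Ez).
congr (_ + _); apply: eq_bigr => k _; apply: eq_bigr => l _.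
  by rewrite Ep.
by rewrite Eq.
Qed.

Lemma linear_deformation_value (f0 : {mpoly C[2]}) (f e : germ C) n :
    (forall i j, f i j = coef2 f0 i j) -> f 0%N 0%N = 0 -> e 0%N 0%N = 0 ->
    (forall s : C, s != 0 -> mu (f + kc s * e) n) ->
  gen_milnor_values f0 n.
Proof.
move=> Ef f00 e00 H; exists (linear_deformation f e); split.
  split=> [|i j|[|[|k]]] //; first exact: linear_deformation_convergent.
  exact: Ef.
exists 1; split=> [|s /andP[s0 _]]; first exact: ltr01.
rewrite normr_gt0 in s0.
exists (fun i j => (f + kc s * e) i j); split; last exact: (mu_milnor _ (H s s0)).
(* From two terms on, the partial sums are equal to the fibre. *)
move=> i j eps eps0; exists 2%N => -[|[|m]] // _.
by rewrite linear_deformation_sum subrr normr0.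
Qed.

(** * Choice of the family for a given value *)

Lemma square_bracket k : exists n, (n * n <= k < n.+1 * n.+1)%N.
Proof.
have ex : exists m, (k < m * m)%N by exists k.+1; nia.
case: (ex_minnP ex) => -[|n] // kn min; exists n; rewrite kn andbT leqNgt.
by apply/negP => /min; rewrite ltnn.
Qed.

(** Here [m = n + 1] and [b = n(n+1) - k]; the lower bound [n^2 <= k] is what gives [b <= n]. *)
Lemma family_A_index n k : (n * n <= k)%N -> (k <= n.+1 * n)%N ->
  exists b c, n = (c + b)%N /\ k = (n * (b + n.+1) - b * n.+1)%N.
Proof.
move=> k1 k2; exists (n.+1 * n - k)%N, (n - (n.+1 * n - k))%N.
have E : (n * n.+1 = n + n * n)%N by rewrite mulnS.
rewrite mulSn in k2 *; rewrite mulnDr E; move: (n * n)%N k1 k2 {E} => N k1 k2.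
split; first by lia.
have [b Eb] : exists b, b = (n + N - k)%N by exists (n + N - k)%N.
by rewrite -Eb mulnS [(b * n)%N]mulnC; move: (n * b)%N => M; lia.
Qed.

(** Here [m = n + 1] and [a + 2 = k - n(n+1)], which lies between 2 and [n]. *)
Lemma family_B_index n k : (n.+1 * n + 1 < k)%N -> (k < n.+1 * n.+1)%N ->
  exists a b, n = (a + b).+2 /\ k = (n.+2 + ((n.+1 + b.+2) * n - b.+2 * n.+1))%N.
Proof.
move=> k1 k2; exists (k - n.+1 * n - 2)%N, (n - (k - n.+1 * n))%N.
have E : (n.+1 * n.+1 = n.+1 * n + n.+1)%N by rewrite mulnS addnC.
have nN : (n <= n.+1 * n)%N by rewrite leq_pmull.
rewrite E in k2; rewrite mulnDl; move: (n.+1 * n)%N k1 k2 nN {E} => N k1 k2 nN.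
split; first by lia.
have [b Eb] : exists b, b = (n - (k - N))%N by exists (n - (k - N))%N.
by rewrite -Eb mulnS; move: (b.+2 * n)%N => M; lia.
Qed.

Theorem theorem2 (d : nat) (f0 : {mpoly C[2]}) :
  (3 <= d)%N -> homogeneous_singularity d f0 ->
  forall k : nat, (k <= (d - 1) * (d - 2) + 1)%N -> gen_milnor_values f0 k.
Proof.
move=> d3 [_ f0h f0s] k kd.
pose Q := dehom d f0.
have sQ : (size Q <= d.+1)%N := size_dehom d f0.
have Ef i j : hom d Q i j = coef2 f0 i j by rewrite -mcoeff_dehom.
have hom00 n (P : {poly C}) : hom n.+1 P 0%N 0%N = 0 by rewrite homE.
have f_00 : hom d Q 0%N 0%N = 0 by rewrite (_ : d = d.-1.+1) ?hom00 //; lia.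
have if00 (b : bool) n (P : {poly C}) : (if b then 0 else hom n.+1 P) 0%N 0%N = 0.
  by case: b; rewrite ?hom00.
have [n /andP[k1 k2]] := square_bracket k.
(* Otherwise [k >= (d-1)^2], which exceeds [(d-1)(d-2) + 1] for [d >= 3]. *)
have nd : (n.+2 <= d)%N.
  rewrite leqNgt; apply/negP => dn; have : (d.-1 * d.-1 <= n * n)%N by apply: leq_mul; lia.
  have -> : (d.-1 * d.-1 = (d - 1) * (d - 2) + d.-1)%N.
    by rewrite -subn1 -mulnSr (_ : (d - 2).+1 = (d - 1)%N) //; clear -d3; lia.
  by move: ((d - 1) * (d - 2))%N kd => N; lia.
have [kA|kA] := leqP k (n.+1 * n).
  have [b [c [En ->]]] := family_A_index k1 kA.
  have [rho Qr] := nonroot_exists (dehom_neq0 d3 f0h f0s).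
  have c0 : c.+1%:R != 0 :> C by rewrite pnatr_eq0.
  have [kappa [kap0 kap1 cop]] := @kappa_exists _ _ rho c.+1%:R (c + b).+1%:R b
    (dehom_deriv_neq0 d3 f0h f0s) c0.
  rewrite En; rewrite En in nd; apply: (linear_deformation_value Ef f_00); last first.
    by move=> s s0; apply: mu_A Qr kap0 kap1 cop s0.
  by rewrite germDE hom00 if00 addr0.
have [rho [Q1 [QE Q10]]] := dehom_root d3 f0h f0s.
have [kC|kC] := eqVneq k (n.+1 * n).+1.
  have [h Eh] : exists h, n = h.+1.
    by case: n k2 {k1 kA nd} kC => [|h _ _]; [move=> + E; rewrite E | exists h].
  have -> : k = (h.+2 + h.+1 * h.+1)%N by rewrite kC Eh mulSn; lia.
  rewrite Eh in nd; apply: (linear_deformation_value Ef f_00); last first.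
    by move=> s s0; apply: mu_C QE Q10 nd s0.
  by rewrite germDE hom00 if00 addr0.
have kB : (n.+1 * n + 1 < k)%N by move: kA kC; move: (n.+1 * n)%N => N; lia.
have [a [b [En Ek]]] := family_B_index kB k2.
(* For [n + 2 = d] the bound of the theorem reads [k <= (n+1) n + 1], against [kB]; so degree
   [n + 3] is available. *)
have nd' : (n.+3 <= d)%N.
  rewrite ltn_neqAle nd andbT; apply/eqP => Ed; move: kB kd; rewrite -Ed !subSS !subn0.
  by move: (n.+1 * n)%N => N; lia.
rewrite En in Ek nd'; rewrite Ek; apply: (linear_deformation_value Ef f_00); last first.
  by move=> s s0; apply: mu_B QE Q10 nd' s0.
by rewrite !germDE !hom00 if00 !addr0.
Qed.
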